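(* Let $d\ge1$ and let $g:(0,\infty)^d\to\mathbb C$ be an upper-tail potential with representing measure $\mu_g$. Then, in the sense of distributions on $(0,\infty)^d$, $$\mu_g=(-1)^dD_1\cdots D_dg,$$ where $D_k$ denotes the distributional partial derivative in the $k$-th variable. In particular, the representing measure is uniquely determined by $g$.
   Context: For $x\in(0,\infty)^d$ put $\mathcal Q^*(x)=\prod_{k=1}^d[x_k,\infty)$. A complex Radon measure on $(0,\infty)^d$ is understood locally (its total variation $|\mu|$ is finite on compact sets but not necessarily on the whole space). A measurable function $g:(0,\infty)^d\to\mathbb C$ is an upper-tail potential with representing measure $\mu_g$ if $\mu_g$ is a complex Radon measure on $(0,\infty)^d$ such that $g(x)=\mu_g(\mathcal Q^*(x))$ for almost every $x\in(0,\infty)^d$ and $$\int_{(0,\infty)^d}\prod_{k=1}^d\min\{r_k,t_k\}\,d|\mu_g|(t)<\infty\quad\text{for every }r\in(0,\infty)^d.$$ The second condition implies $|\mu_g|(\mathcal Q^*(x))<\infty$ for every $x$, so the tail is well defined; it also implies $g\in L^1_{\mathrm{loc}}((0,\infty)^d)$. *)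

(* Defs.v *)
From HB Require Import structures.
From mathcomp Require Import all_boot all_order all_algebra.
From mathcomp Require Import all_classical all_reals all_analysis.
From mathcomp Require Import complex.

Set Implicit Arguments.
Unset Strict Implicit.
Unset Printing Implicit Defensive.
Import Order.TTheory GRing.Theory Num.Theory.
Import numFieldNormedType.Exports.

Local Open Scope classical_set_scope.
Local Open Scope ring_scope.
Local Open Scope complex_scope.

Local Notation Re := complex.Re.
Local Notation Im := complex.Im.

Definition row_display : measure_display. Proof. exact. Qed.

(* The product sigma-algebra on R^n, generated by the coordinate functions;
   it is the Borel sigma-algebra. *)
Section row_measurable.
Context {R : realType} (n : nat).

Let coord (i : 'I_n) (x : 'rV[R]_n) : measurableTypeR R := x 0 i.

Let row_set0 : g_sigma_preimage coord set0.
Proof. exact: sigma_algebra0. Qed.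

Let row_setC A : g_sigma_preimage coord A -> g_sigma_preimage coord (~` A).
Proof. exact: sigma_algebraC. Qed.

Let row_bigcup (F : _^nat) : (forall i, g_sigma_preimage coord (F i)) ->
  g_sigma_preimage coord (\bigcup_i (F i)).
Proof. exact: sigma_algebra_bigcup. Qed.

HB.instance Definition _ := @isMeasurable.Build row_display
  'rV[R]_n (g_sigma_preimage coord) row_set0 row_setC row_bigcup.

End row_measurable.

Lemma measurable_row_coord (R : realType) n (i : 'I_n) :
  measurable_fun [set: 'rV[R]_n]
    (fun x : 'rV[R]_n => x 0 i : measurableTypeR R).
Proof.
move=> _ Y mY; rewrite setTI; apply: sub_sigma_algebra => /=.
rewrite -bigcup_seq/=; exists i => /=; first by rewrite mem_index_enum.
by exists Y => //; rewrite setTI.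
Qed.

Lemma measurable_fun_row d (T : measurableType d) (R : realType) n
    (f : T -> 'rV[R]_n) :
  (forall i, measurable_fun [set: T] (fun t => f t 0 i : measurableTypeR R)) ->
  measurable_fun [set: T] f.
Proof.
move=> mf _ Y mY; rewrite setTI.
pose F := [set A : set 'rV[R]_n | measurable (f @^-1` A)].
suff : F Y by [].
apply: mY; split.
  split; first by rewrite /F/= preimage_set0.
  - by move=> A FA; rewrite /F/= setTD preimage_setC; exact: measurableC.
  - by move=> G FG; rewrite /F/= preimage_bigcup; exact: bigcupT_measurable.
move=> A; rewrite -bigcup_seq/= => -[i _ [B mB <-]].
by have := mf i measurableT B mB; rewrite /F/= !setTI.
Qed.

Lemma sigma_finite_product_measure1 d1 d2 (T1 : measurableType d1)
    (T2 : measurableType d2) (R : realType)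
    (m1 : {sigma_finite_measure set T1 -> \bar R})
    (m2 : {sigma_finite_measure set T2 -> \bar R}) :
  sigma_finite setT (m1 \x m2)%E.
Proof.
have /sigma_finiteP[F [TF ndF Foo]] := sigma_finiteT m1.
have /sigma_finiteP[G [TG ndG Goo]] := sigma_finiteT m2.
exists (fun n => F n `*` G n).
  rewrite -setXTT TF TG predeqE => -[x y]; split.
    move=> [/= [n _ Fnx] [k _ Gky]]; exists (maxn n k) => //; split.
    - by move: x Fnx; exact/subsetPset/ndF/leq_maxl.
    - by move: y Gky; exact/subsetPset/ndG/leq_maxr.
  by move=> [n _ []/= ? ?]; split; exists n.
move=> k; have [? ?] := Foo k; have [? ?] := Goo k.
split; first exact: measurableX.
by rewrite product_measure1E// lte_mul_pinfty// ge0_fin_numE.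
Qed.

(* Lebesgue measure on R^n, as the iterated product of the one on R. *)
Section lebesgue_row.
Context {R : realType}.

Definition cons_row n (p : measurableTypeR R * 'rV[R]_n) : 'rV[R]_n.+1 :=
  row_mx (const_mx p.1 : 'rV_1) p.2.

Fixpoint lebesgue_row n : set 'rV[R]_n -> \bar R :=
  match n with
  | 0 => \d_(0 : 'rV[R]_0)
  | m.+1 => pushforward (lebesgue_measure \x @lebesgue_row m)%E (@cons_row m)
  end.

Let uncons_row n (x : 'rV[R]_n.+1) : measurableTypeR R * 'rV[R]_n :=
  (x 0 0, rsubmx (x : 'rV_(1 + n))).

Let cons_rowK n : cancel (@cons_row n) (@uncons_row n).
Proof.
case=> a v; rewrite /cons_row /uncons_row row_mxKr; congr pair.
rewrite (_ : 0 = lshift n (0 : 'I_1)); last exact/val_inj.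
by rewrite (row_mxEl (const_mx a : 'rV_1) v) mxE.
Qed.

Lemma measurable_cons_row n : measurable_fun setT (@cons_row n).
Proof.
apply: measurable_fun_row => i.
case: (split_ordP (i : 'I_(1 + n))) => j ->.
  rewrite [X in measurable_fun _ X](_ : _ = fst); first exact: measurable_fst.
  by apply/funext => -[a v]; rewrite (row_mxEl (const_mx a : 'rV_1) v) mxE.
rewrite [X in measurable_fun _ X](_ : _ = (fun x : 'rV[R]_n => x 0 j) \o snd).
  exact: (measurableT_comp (measurable_row_coord j) measurable_snd).
by apply/funext => -[a v]; rewrite (row_mxEr (const_mx a : 'rV_1) v).
Qed.

Let measurable_uncons_row n : measurable_fun setT (@uncons_row n).
Proof.
apply/measurable_fun_pairP; split; first exact: measurable_row_coord.
apply: measurable_fun_row => i.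
under eq_fun do rewrite /= mxE.
exact: measurable_row_coord.
Qed.

Let lebesgue_row_sigma_finite n :
  exists mu : {sigma_finite_measure set 'rV[R]_n -> \bar R},
    @lebesgue_row n = mu.
Proof.
elim: n => [|n [mu IH]]; first by exists \d_(0 : 'rV[R]_0).
have mcons := @measurable_cons_row n.
pose m : {measure set (measurableTypeR R * 'rV[R]_n)%type -> \bar R} :=
  (@lebesgue_measure R \x mu)%E.
pose nu : {measure set _ -> \bar R} :=
  measure_function_pushforward__canonical__measure_function_Measure
   m mcons.
have nuE : @lebesgue_row n.+1 = nu by rewrite /= IH.
have nufin : sigma_finite setT nu.
  have [F FT Ffin] := sigma_finite_product_measure1 (@lebesgue_measure R) mu.
  exists (fun i => @uncons_row n @^-1` F i).
    by rewrite -preimage_bigcup -FT preimage_setT.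
  move=> i; have [mF Foo] := Ffin i; split.
    by rewrite -[X in measurable X]setTI; exact: measurable_uncons_row.
  by rewrite /nu/= /pushforward -comp_preimage (_ : _ \o _ = id) ?preimage_id//;
    apply/funext => x /=; rewrite cons_rowK.
pose S := Measure_isSigmaFinite.Build _ _ _ nu nufin.
pose M : {sigma_finite_measure set 'rV[R]_n.+1 -> \bar R} :=
  HB.pack (nu : set _ -> \bar R) nu S.
by exists M; rewrite nuE.
Qed.

Let lebesgue_row0 n : @lebesgue_row n set0 = 0%E.
Proof. by have [mu ->] := lebesgue_row_sigma_finite n; exact: measure0. Qed.

Let lebesgue_row_ge0 n A : (0 <= @lebesgue_row n A)%E.
Proof. by have [mu ->] := lebesgue_row_sigma_finite n; exact: measure_ge0. Qed.

Let lebesgue_row_sigma_additive n : semi_sigma_additive (@lebesgue_row n).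
Proof.
have [mu ->] := lebesgue_row_sigma_finite n.
exact: measure_semi_sigma_additive.
Qed.

HB.instance Definition _ n := isMeasure.Build _ _ _ (@lebesgue_row n)
  (@lebesgue_row0 n) (@lebesgue_row_ge0 n) (@lebesgue_row_sigma_additive n).

Let lebesgue_row_sigma_finiteT n : sigma_finite setT (@lebesgue_row n).
Proof. by have [mu ->] := lebesgue_row_sigma_finite n; exact: sigma_finiteT. Qed.

HB.instance Definition _ n := Measure_isSigmaFinite.Build _ _ _ (@lebesgue_row n)
  (@lebesgue_row_sigma_finiteT n).

End lebesgue_row.

Definition orthant {R : realType} {d} : set 'rV[R]_d :=
  [set x | forall k, 0 < x 0 k].

Definition upper_set {R : realType} {d} (x : 'rV[R]_d) : set 'rV[R]_d :=
  [set t | forall k, x 0 k <= t 0 k].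

(* Complex Radon measures on the open orthant.  Such a measure [mu] is a set
   function with values in C whose domain is the delta-ring of the Borel subsets
   of the orthant that have finite total variation; the values of [mu] at other
   sets are irrelevant. *)
Section complex_radon_measure.
Context {R : realType} {d : nat}.
Implicit Types (mu : set 'rV[R]_d -> R[i]) (A B : set 'rV[R]_d).

Definition bounded_borel B : Prop :=
  measurable B /\ exists K, [/\ compact K, K `<=` orthant & B `<=` K].

(* |mu|(A); by countable additivity the pieces may be taken relatively compact. *)
Definition abs_variation mu A : \bar R :=
  ereal_sup [set s | exists n (B : 'I_n -> set 'rV[R]_d),
    [/\ forall i, bounded_borel (B i), forall i, B i `<=` A, trivIset setT B &
        s = (\sum_(i < n) Normc.normc (mu (B i)))%:E]].

Definition finite_variation mu A : Prop :=
  [/\ measurable A, A `<=` orthant & (abs_variation mu A < +oo)%E].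

Definition complex_cvg (u : nat -> R[i]) (l : R[i]) : Prop :=
  (Re (u n) @[n --> \oo] --> Re l) /\ (Im (u n) @[n --> \oo] --> Im l).

Record complex_radon mu : Prop := ComplexRadon {
  complex_radon_sigma_additive : forall F : nat -> set 'rV[R]_d,
    (forall i, measurable (F i)) -> trivIset setT F ->
    finite_variation mu (\bigcup_i F i) ->
    complex_cvg (fun n => \sum_(i < n) mu (F i)) (mu (\bigcup_i F i)) ;
  complex_radon_locally_finite : forall K, compact K -> K `<=` orthant ->
    (abs_variation mu K < +oo)%E ;
  complex_radon_inner_regular : forall A, measurable A -> A `<=` orthant ->
    abs_variation mu A =
    ereal_sup [set abs_variation mu K | K in [set K | compact K /\ K `<=` A]]
}.

Definition complex_radon_eq mu nu : Prop :=
  (forall A, finite_variation mu A <-> finite_variation nu A) /\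
  (forall A, finite_variation mu A -> mu A = nu A).

(* When [mu] is a complex Radon measure, [abs_variation mu] and the positive and
   negative variations of Re mu and Im mu (their Jordan decompositions) are
   measures on the orthant; the library integral is defined for arbitrary set
   functions. *)
Definition pos_variation (nu : set 'rV[R]_d -> R) A : \bar R :=
  ereal_sup [set (nu B)%:E | B in [set B | bounded_borel B /\ B `<=` A]].

Definition neg_variation (nu : set 'rV[R]_d -> R) A : \bar R :=
  pos_variation (fun B => - nu B) A.

Definition signed_integral (nu : set 'rV[R]_d -> R) (f : 'rV[R]_d -> R) : R :=
  fine (\int[pos_variation nu]_(t in orthant) (f t)%:E)%E -
  fine (\int[neg_variation nu]_(t in orthant) (f t)%:E)%E.

Definition complex_integral mu (f : 'rV[R]_d -> R[i]) : R[i] :=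
  let re B := Re (mu B) in let im B := Im (mu B) in
  let f1 t := Re (f t) in let f2 t := Im (f t) in
  (signed_integral re f1 - signed_integral im f2) +i*
  (signed_integral re f2 + signed_integral im f1).

End complex_radon_measure.

(* C_c^oo((0,oo)^d; C), each function being extended by zero to R^d. *)
Section distributions.
Context {R : realType} {d : nat}.

Definition partial (k : 'I_d) (f : 'rV[R]_d -> R) : 'rV[R]_d -> R :=
  fun x => 'D_(delta_mx 0 k) f x.

Definition smooth (f : 'rV[R]_d -> R) : Prop :=
  forall s : seq 'I_d, let Df := foldr partial f s in
    continuous Df /\ forall k x, derivable Df x (delta_mx 0 k).

Definition cpartial (k : 'I_d) (phi : 'rV[R]_d -> R[i]) : 'rV[R]_d -> R[i] :=
  fun x => partial k (fun y => Re (phi y)) x +i*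
           partial k (fun y => Im (phi y)) x.

Definition test_support (phi : 'rV[R]_d -> R[i]) : set 'rV[R]_d :=
  closure [set x | phi x != 0].

Definition test_function (phi : 'rV[R]_d -> R[i]) : Prop :=
  [/\ smooth (fun x => Re (phi x)), smooth (fun x => Im (phi x)),
      compact (test_support phi) & test_support phi `<=` orthant].

(* Functionals; only their values at test functions are meaningful. *)
Definition functional : Type := ('rV[R]_d -> R[i]) -> R[i].

Definition distr_eq (T S : functional) : Prop :=
  forall phi, test_function phi -> T phi = S phi.

Definition distr_of_measure (mu : set 'rV[R]_d -> R[i]) : functional :=
  fun phi => complex_integral mu phi.

(* The library integral is a supremum over Borel simple functions, so it is also
   the Lebesgue integral when [g] is only Lebesgue measurable. *)
Definition distr_of_fun (g : 'rV[R]_d -> R[i]) : functional := fun phi =>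
  (\int[@lebesgue_row R d]_(x in orthant) Re (g x * phi x)) +i*
  (\int[@lebesgue_row R d]_(x in orthant) Im (g x * phi x)).

Definition distr_partial (k : 'I_d) (T : functional) : functional :=
  fun phi => - T (cpartial k phi).

Definition distr_scale (c : R[i]) (T : functional) : functional :=
  fun phi => c * T phi.

Definition distr_mixed_partial (T : functional) : functional :=
  foldr distr_partial T (enum 'I_d).

End distributions.

Definition lebesgue_measurable_set {R : realType} {d} (A : set 'rV[R]_d) : Prop :=
  exists2 B, measurable B &
    (@lebesgue_row R d).-negligible ((A `\` B) `|` (B `\` A)).

Definition lebesgue_measurable_fun {R : realType} {d} (f : 'rV[R]_d -> R) : Prop :=
  forall Y : set (measurableTypeR R), measurable Y ->
    lebesgue_measurable_set (orthant `&` f @^-1` Y).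

Record upper_tail_potential (R : realType) d (g : 'rV[R]_d -> R[i])
    (mu : set 'rV[R]_d -> R[i]) : Prop := UpperTailPotential {
  upper_tail_measurable : lebesgue_measurable_fun (fun x => Re (g x)) /\
                          lebesgue_measurable_fun (fun x => Im (g x)) ;
  upper_tail_radon : complex_radon mu ;
  upper_tail_eq : {ae @lebesgue_row R d,
    forall x, orthant x -> g x = mu (upper_set x)} ;
  upper_tail_integrable : forall r : 'rV[R]_d, orthant r ->
    (\int[abs_variation mu]_(t in orthant)
      (\prod_(k < d) Num.min (r 0 k) (t 0 k))%:E < +oo)%E
}.

(* Main.v *)
From HB Require Import structures.
Require Import Defs.
From mathcomp Require Import all_boot all_order all_algebra.
From mathcomp Require Import all_classical all_reals all_analysis.
From mathcomp Require Import measurable_realfun complex ring lra.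

(** The tail of a measure is integrated against a derivative of the test
   function, and the order of integration is exchanged.  Let phi be a test
   function and Psi = D_d ... D_1 phi.  As phi vanishes where a coordinate is 0,
   the fundamental theorem of calculus, used once in each variable, gives
     int_(0 < x <= t) Psi(x) dx = phi(t)   ([integral_obox_mixed_partial]).
   Integrating this in t against a positive measure m and exchanging the
   integrals over the set of pairs 0 < x <= t yields
     int phi dm = int m(Q^*(x)) Psi(x) dx   ([integral_tail_mixed_partial]).
   The exchange is legitimate because Psi is bounded and vanishes outside a box
   (0, r], so that the absolute double integral is at most a constant times the
   integral of the product of the min(r_k, t_k).

   A complex Radon measure mu is reduced to positive ones: the positive and
   negative variations of Re mu and Im mu are sigma-finite measures
   ([pos_variation_measure]) below the total variation, and their difference is
   Re mu or Im mu on every set of finite variation ([coord_finite_variation]).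
   Summing the four identities gives the pairing of mu with phi as the integral
   of g Psi, and the d signs met when the distributional derivatives are moved
   to phi form the factor (-1)^d.

   Uniqueness is obtained on the level of sets.  Two representing measures have
   equal tails almost everywhere.  Tails are left-continuous and every box has
   positive Lebesgue measure, so that the tails agree at each point of the
   orthant ([upper_tail_potential_eq_tails]).  Upper sets are stable under
   intersection and generate the Borel sets, so the two measures agree on
   relatively compact Borel sets ([coordinate_bounded_borel_eq]), which determine
   a complex Radon measure. *)

Set Implicit Arguments.
Unset Strict Implicit.
Unset Printing Implicit Defensive.
Import Order.TTheory GRing.Theory Num.Theory.
Import numFieldNormedType.Exports.

Local Open Scope classical_set_scope.
Local Open Scope ring_scope.

Local Notation Re := complex.Re.
Local Notation Im := complex.Im.

(** * Borel sets of row vectors *)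

Section row_borel.
Context {R : realType} {n : nat}.
Local Notation V := 'rV[R]_n.

Lemma measurable_coordwise (A : 'I_n -> set R) :
  (forall k, measurable (A k : set (measurableTypeR R))) ->
  measurable [set x : V | forall k, A k (x 0 k)].
Proof.
move=> mA.
rewrite (_ : mkset _ = \bigcap_(k in [set: 'I_n])
  ((fun x : V => x 0 k) @^-1` A k)).
  apply: fin_bigcap_measurable => // k _.
  by rewrite -[X in measurable X]setTI; exact: measurable_row_coord.
by apply/seteqP; split => x /= Ax k; [move=> _|]; exact: Ax.
Qed.

Lemma measurable_orthant : measurable (@orthant R n).
Proof.
rewrite (_ : orthant = [set x : V | forall k, `]0, +oo[%classic (x 0 k)]).
  by apply: (measurable_coordwise (A := fun=> `]0, +oo[%classic)).
by apply/seteqP; split => x /= xk k; move: (xk k); rewrite in_itv/= andbT.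
Qed.

Lemma measurable_upper_set (x : V) : measurable (upper_set x).
Proof.
rewrite (_ : upper_set x = [set t : V | forall k, `[x 0 k, +oo[%classic
  (t 0 k)]).
  by apply: (measurable_coordwise (A := fun k => `[x 0 k, +oo[%classic)).
by apply/seteqP; split => t /= tk k; move: (tk k); rewrite in_itv/= andbT.
Qed.

(** An open set is a countable union of cubes with rational centre and
   radius 1/(N+1), and cubes belong to the product sigma-algebra. *)
Lemma open_measurable_row (U : set V) : open U -> measurable U.
Proof.
move=> oU.
pose box (p : 'rV[rat]_n * nat) :=
  [set x : V | forall k, ball (ratr (p.1 0 k) : R) p.2.+1%:R^-1 (x 0 k)].
rewrite (_ : U = \bigcup_p (if `[< box p `<=` U >] then box p else set0)).
  apply: countable_bigcupT_measurable => [|p]; first exact: countableP.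
  case: asboolP => [_|_]; last exact: measurable0.
  rewrite /box.
  have mb k : measurable
    (ball (ratr (p.1 0 k) : R) p.2.+1%:R^-1 : set (measurableTypeR R)).
    by apply: open_measurable; exact: ball_open.
  exact: (measurable_coordwise mb).
apply/seteqP; split => [x Ux|x [p _]]; last by case: asboolP => [pU /pU|_ []].
have /nbhs_ballP[e /= e0 xeU] : nbhs x U by exact: open_nbhs_nbhs.
(* two points of a cube of this radius are less than e apart *)
have [N Ne] : exists N : nat, N.+1%:R^-1 < e / 2.
  have e20 : (0 : R) < e / 2 by rewrite divr_gt0.
  by have [N _ /(_ N (leqnn _))] := near_infty_natSinv_lt (PosNum e20);
    exists N.
have /choice[q qP] : forall k : 'I_n, exists q : rat,
    ball (x 0 k : R) N.+1%:R^-1 (ratr q).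
  move=> k; have /rat_in_itvoo[q] : x 0 k - N.+1%:R^-1 < x 0 k + N.+1%:R^-1.
    by rewrite ltrD2l gtrN.
  rewrite in_itv/= => /andP[q1 q2]; exists q.
  by rewrite /ball/= ltr_distlC q1 q2.
exists (\row_k q k, N) => //; case: asboolP => [_|[]]; last first.
  move=> y ybox; apply: xeU; split => // i j.
  have xq := ball_sym (qP j); have qy := ybox j; rewrite /= mxE in qy.
  rewrite (ord1 i); apply: (ball_splitr (z := (ratr (q j) : R))).
    exact: (le_ball (ltW Ne)).
  exact: (le_ball (ltW Ne)).
by move=> k /=; rewrite mxE; apply: ball_sym.
Qed.

Lemma continuous_measurable_row (f : V -> R) :
  continuous f -> measurable_fun setT (f : V -> measurableTypeR R).
Proof.
move=> /continuousP cf; apply: (measurability _ (RGenOpens.measurableE R)).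
move=> _ [_ [a [b ->] <-]].
rewrite setTI; apply: open_measurable_row; apply: cf; exact: interval_open.
Qed.

End row_borel.

(** * Lebesgue measure of boxes *)

Section lebesgue_row_theory.
Context {R : realType}.
Local Notation leb := (@lebesgue_measure R).

Lemma cons_row0 n (a : R) (v : 'rV[R]_n) : cons_row (a, v) 0 ord0 = a.
Proof.
rewrite /cons_row (_ : ord0 = lshift n (0 : 'I_1)); last exact/val_inj.
by rewrite (row_mxEl (const_mx a : 'rV_1) v) mxE.
Qed.

Lemma cons_rowS n (a : R) (v : 'rV[R]_n) k :
  cons_row (a, v) 0 (lift ord0 k) = v 0 k.
Proof.
rewrite /cons_row (_ : lift ord0 k = rshift 1 k); last exact/val_inj.
by rewrite (row_mxEr (const_mx a : 'rV_1) v).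
Qed.

Lemma forall_cons_row n (P : 'I_n.+1 -> R -> Prop) (a : R) (v : 'rV[R]_n) :
  (forall k, P k (cons_row (a, v) 0 k)) <->
  P ord0 a /\ forall k, P (lift ord0 k) (v 0 k).
Proof.
split=> [h|[h0 h] k].
  by split=> [|k]; [have := h ord0; rewrite cons_row0
                   |have := h (lift ord0 k); rewrite cons_rowS].
by case: (unliftP ord0 k) => [j ->|->]; rewrite ?cons_row0 ?cons_rowS.
Qed.

Lemma row_consE n (x : 'rV[R]_n.+1) :
  x = cons_row (x 0 ord0, \row_k x 0 (lift ord0 k)).
Proof.
apply/rowP => k; case: (unliftP ord0 k) => [j ->|->];
  by rewrite ?cons_row0 ?cons_rowS ?mxE.
Qed.

(** Lebesgue measure on R^(n+1) is a pushforward of a product, so that Fubini's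
   theorem peels off the first coordinate. *)
Lemma ge0_integral_lebesgue_rowS n (D : set 'rV[R]_n.+1)
    (f : 'rV[R]_n.+1 -> \bar R) :
  measurable D -> measurable_fun D f -> {in D, forall y, (0 <= f y)%E} ->
  (\int[@lebesgue_row R n.+1]_(x in D) f x =
   \int[leb \x @lebesgue_row R n]_(p in @cons_row R n @^-1` D) f
     (cons_row p))%E.
Proof.
move=> mD mf f0.
exact: (ge0_integral_pushforward (@measurable_cons_row R n)
  (leb \x @lebesgue_row R n)%E mD mf f0).
Qed.

Lemma integrable_lebesgue_rowS n (D : set 'rV[R]_n.+1)
    (f : 'rV[R]_n.+1 -> \bar R) :
  measurable D -> measurable_fun setT f ->
  (@lebesgue_row R n.+1).-integrable D f ->
  (leb \x @lebesgue_row R n)%E.-integrable (@cons_row R n @^-1` D)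
    (f \o @cons_row R n).
Proof.
move=> mD mf fi.
have mD' : measurable (@cons_row R n @^-1` D).
  by rewrite -[X in measurable X]setTI; exact: measurable_cons_row.
apply/integrableP; split.
  by apply: measurable_funTS; apply: measurableT_comp => //;
    exact: measurable_cons_row.
move/integrableP : fi => [_].
rewrite ge0_integral_lebesgue_rowS//.
by apply: measurableT_comp => //; exact: measurable_funTS.
Qed.

Lemma integral_lebesgue_rowS n (D : set 'rV[R]_n.+1)
    (f : 'rV[R]_n.+1 -> \bar R) :
  measurable D -> measurable_fun setT f ->
  (@lebesgue_row R n.+1).-integrable D f ->
  (\int[@lebesgue_row R n.+1]_(x in D) f x =
   \int[leb \x @lebesgue_row R n]_(p in @cons_row R n @^-1` D) f
     (cons_row p))%E.
Proof.
move=> mD mf fi.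
apply: (integral_pushforward (@measurable_cons_row R n)
  (mu := (leb \x @lebesgue_row R n)%E)) => //.
exact: integrable_lebesgue_rowS.
Qed.

(** Half-open boxes: with lower corner 0 and upper corner t this is exactly the
   set of x in the orthant such that t lies in the upper set of x. *)
Definition obox n (a b : 'I_n -> R) : set 'rV[R]_n :=
  [set x | forall k, a k < x 0 k <= b k].

Lemma measurable_obox n (a b : 'I_n -> R) : measurable (obox a b).
Proof.
rewrite (_ : obox a b = [set x : 'rV[R]_n | forall k, `]a k, b k]%classic
  (x 0 k)]).
  by apply: (measurable_coordwise (A := fun k => `]a k, b k]%classic)).
by apply/seteqP; split => x /= xk k; have := xk k; rewrite in_itv.
Qed.

Lemma obox_cons n (a b : 'I_n.+1 -> R) :
  @cons_row R n @^-1` obox a b =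
  `]a ord0, b ord0] `*` obox (a \o lift ord0) (b \o lift ord0).
Proof.
apply/seteqP; split => -[r v]/=.
  move/(forall_cons_row (fun k r => a k < r <= b k)) => [h h'].
  by split => //=; rewrite in_itv.
move=> [/= h h']; apply/(forall_cons_row (fun k r => a k < r <= b k)).
by split => //; move: h; rewrite in_itv.
Qed.

Lemma lebesgue_row_obox n (a b : 'I_n -> R) : (forall k, a k <= b k) ->
  @lebesgue_row R n (obox a b) = (\prod_(k < n) (b k - a k))%:E.
Proof.
elim: n => [|n IH] in a b * => ab.
  rewrite big_ord0 /= diracE mem_set//.
  by case.
rewrite big_ord_recl EFinM -(IH (a \o lift ord0) (b \o lift ord0)); last first.
  by move=> k; exact: ab.
rewrite (_ : lebesgue_row _ = (leb \x @lebesgue_row R n)%E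
  (@cons_row R n @^-1` obox a b)) //.
rewrite obox_cons [LHS](product_measure1E leb (@lebesgue_row R n))//;
  last exact: measurable_obox.
by rewrite [X in (X * _)%E](lebesgue_measure_itv `]a ord0, b ord0])/= lte_fin;
  case: ltP (ab ord0) => // ba ab0;
  rewrite (@le_anti _ _ (a ord0) (b ord0)) ?subrr ?ab0.
Qed.

End lebesgue_row_theory.

(** * Iterated fundamental theorem of calculus *)

Section mixed_partial.
Context {R : realType}.
Local Notation leb := (@lebesgue_measure R).

Lemma continuous_row (T : topologicalType) n (g : T -> 'rV[R]_n) :
  (forall k, continuous (fun t => g t 0 k)) -> continuous g.
Proof.
move=> cg t; apply/cvg_ballP => e e0.
have : \forall y \near t, forall k, ball (g t 0 k) e (g y 0 k).
  by apply: filter_forall => k; exact: (cvg_ball (cg k t)).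
apply: filterS => y gy; split => // i j; rewrite (ord1 i); exact: gy.
Qed.

Lemma continuous_cons_rowr n (a : R) :
  continuous (fun v : 'rV[R]_n => cons_row (a, v)).
Proof.
apply: continuous_row => k; case: (unliftP ord0 k) => [j ->|->] v.
  rewrite (_ : (fun _ => _) = (fun v : 'rV[R]_n => v 0 j)).
    exact: coord_continuous.
  by apply/funext => w; rewrite cons_rowS.
rewrite (_ : (fun _ => _) = fun=> a); first exact: cst_continuous.
by apply/funext => w; rewrite cons_row0.
Qed.

Lemma continuous_cons_rowl n (v : 'rV[R]_n) :
  continuous (fun a : R => cons_row (a, v)).
Proof.
apply: continuous_row => k; case: (unliftP ord0 k) => [j ->|->] a.
  rewrite (_ : (fun _ => _) = fun=> v 0 j); first exact: cst_continuous.
  by apply/funext => w; rewrite cons_rowS.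
rewrite (_ : (fun _ => _) = id); first by move=> ?; exact: cvg_id.
by apply/funext => w; rewrite cons_row0.
Qed.

Lemma cons_row_shiftr n (a h : R) (v : 'rV[R]_n) k :
  cons_row (a, h *: delta_mx 0 k + v) =
  h *: delta_mx 0 (lift ord0 k) + cons_row (a, v).
Proof.
apply/rowP => j; case: (unliftP ord0 j) => [i ->|->]; rewrite [RHS]mxE.
  by rewrite !cons_rowS !mxE !eqxx (inj_eq lift_inj).
by rewrite !cons_row0 !mxE (negbTE (neq_lift _ _)) andbF mulr0 add0r.
Qed.

Lemma cons_row_shiftl n (a h : R) (v : 'rV[R]_n) :
  cons_row (h + a, v) = h *: delta_mx 0 ord0 + cons_row (a, v).
Proof.
apply/rowP => j; case: (unliftP ord0 j) => [i ->|->]; rewrite [RHS]mxE.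
  by rewrite !cons_rowS !mxE [lift _ _ == _]eq_sym (negbTE (neq_lift _ _)) andbF
    mulr0 add0r.
by rewrite !cons_row0 !mxE !eqxx mulr1.
Qed.

(** Difference quotients agree before any limit is taken; hence both the value
   and the existence of a partial derivative survive freezing a coordinate. *)
Lemma diff_quotient_cons_rowr n (f : 'rV[R]_n.+1 -> R) a v k :
  (fun h : R => h^-1 *: (((fun v => f (cons_row (a, v))) \o shift v)
     (h *: delta_mx 0 k) - f (cons_row (a, v)))) =
  (fun h => h^-1 *: ((f \o shift (cons_row (a, v)))
     (h *: delta_mx 0 (lift ord0 k)) - f (cons_row (a, v)))).
Proof. by apply/funext => h /=; rewrite cons_row_shiftr. Qed.

Lemma diff_quotient_cons_rowl n (f : 'rV[R]_n.+1 -> R) a v :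
  (fun h : R => h^-1 *: (((fun a => f (cons_row (a, v))) \o shift a)
     (h *: 1) - f (cons_row (a, v)))) =
  (fun h => h^-1 *: ((f \o shift (cons_row (a, v)))
     (h *: delta_mx 0 ord0) - f (cons_row (a, v)))).
Proof. by apply/funext => h /=; rewrite [h *: 1]mulr1 cons_row_shiftl. Qed.

Lemma partial_cons_row n (f : 'rV[R]_n.+1 -> R) a k :
  partial k (fun v => f (cons_row (a, v))) =
  fun v => partial (lift ord0 k) f (cons_row (a, v)).
Proof.
by apply/funext => v; rewrite /partial /derive diff_quotient_cons_rowr.
Qed.

Lemma derivable_cons_row n (f : 'rV[R]_n.+1 -> R) a v k :
  derivable f (cons_row (a, v)) (delta_mx 0 (lift ord0 k)) ->
  derivable (fun v => f (cons_row (a, v))) v (delta_mx 0 k).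
Proof.
by rewrite /derivable diff_quotient_cons_rowr.
Qed.

Lemma foldr_partial_cons_row n (f : 'rV[R]_n.+1 -> R) a s :
  foldr partial (fun v => f (cons_row (a, v))) s =
  fun v => foldr partial f (map (lift ord0) s) (cons_row (a, v)).
Proof. by elim: s => //= k s ->; rewrite partial_cons_row. Qed.

(** Freezing the first coordinate keeps smoothness: this is what lets the
   induction on the dimension go through. *)
Lemma smooth_cons_row n (f : 'rV[R]_n.+1 -> R) a :
  smooth f -> smooth (fun v => f (cons_row (a, v))).
Proof.
move=> sf s /=; have [cf df] := sf (map (lift ord0) s).
rewrite foldr_partial_cons_row; split.
  move=> v; apply: (continuous_comp (f := fun v => cons_row (a, v))).
    exact: continuous_cons_rowr.
  exact: cf.
by move=> k v; apply: derivable_cons_row; exact: df.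
Qed.

Lemma smooth_partial n (f : 'rV[R]_n -> R) k : smooth f -> smooth (partial k f).
Proof. by move=> sf s; have := sf (rcons s k); rewrite /= foldr_rcons. Qed.

Lemma smooth_continuous n (f : 'rV[R]_n -> R) : smooth f -> continuous f.
Proof. by move=> /(_ [::])[]. Qed.

Lemma integral_partial0 n (f : 'rV[R]_n.+1 -> R) (v : 'rV[R]_n) (b : R) :
  smooth f -> 0 < b ->
  (\int[leb]_(a in `]0%R, b]) (partial ord0 f (cons_row (a, v)))%:E =
   (f (cons_row (b, v)))%:E - (f (cons_row (0%R, v)))%:E)%E.
Proof.
move=> sf b0.
have cF : continuous (fun a => f (cons_row (a, v))).
  move=> a; apply: (continuous_comp (f := fun a => cons_row (a, v))).
    exact: continuous_cons_rowl.
  exact: smooth_continuous.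
have cf : continuous (fun a => partial ord0 f (cons_row (a, v))).
  move=> a; apply: (continuous_comp (f := fun a => cons_row (a, v))).
    exact: continuous_cons_rowl.
  by apply: smooth_continuous; exact: smooth_partial.
rewrite integral_itv_obnd_cbnd; last first.
  apply: measurable_funTS; apply/measurable_EFinP.
  exact: continuous_measurable_fun.
rewrite (@continuous_FTC2 _ _ (fun a => f (cons_row (a, v))))//.
- exact: continuous_subspaceT.
- split.
  + move=> a _; have := (sf [::]).2 ord0 (cons_row (a, v)).
    by rewrite /derivable diff_quotient_cons_rowl.
  + by apply: cvg_at_right_filter; exact: cF.
  + by apply: cvg_at_left_filter; exact: cF.
- by move=> a _; rewrite derive1E /partial /derive diff_quotient_cons_rowl.
Qed.

Lemma continuous_obox_integrable n (f : 'rV[R]_n -> R) (a b : 'I_n -> R) :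
  (forall k, a k <= b k) -> continuous f ->
  (@lebesgue_row R n).-integrable (obox a b) (EFin \o f).
Proof.
move=> ab cf; apply: measurable_bounded_integrable.
- exact: measurable_obox.
- by rewrite [X in (X < _)%E](lebesgue_row_obox ab) ltry.
- by apply: measurable_funTS; exact: continuous_measurable_row.
pose K := [set v : 'rV[R]_n | forall i, `[a i, b i]%classic (v ord0 i)].
have cK : compact K.
  by apply: (rV_compact (A := fun i => `[a i, b i]%classic)) => i;
    exact: segment_compact.
have : bounded_set (f @` K).
  apply: compact_bounded; apply: continuous_compact => //.
  exact: continuous_subspaceT.
rewrite /bounded_set /bounded_near /=; apply: filterS => M h x /= xab.
apply: h; exists x => // k /=.
by have /andP[/ltW ak kb] := xab k; rewrite in_itv /= ak kb.
Qed.

(** Integrating the derivative in each variable over (0, t_k] leaves only the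
   value at t, since f vanishes where a coordinate is 0.  The derivative in the
   first variable is taken innermost, so for each fixed first coordinate a the
   remaining derivatives act on the section at a of the first partial
   derivative, to which the induction hypothesis applies; partial derivatives
   are never commuted. *)
Theorem integral_obox_mixed_partial n (f : 'rV[R]_n -> R) (t : 'rV[R]_n) :
  smooth f -> (forall (x : 'rV[R]_n) k, x 0 k = 0 -> f x = 0) -> orthant t ->
  (\int[@lebesgue_row R n]_(x in obox (fun=> 0%R) (t ord0))
    (foldr partial f (rev (enum 'I_n)) x)%:E = (f t)%:E)%E.
Proof.
elim: n => [|n IH] in f t * => sf f0 t0.
  have mf : measurable_fun [set: 'rV[R]_0] (EFin \o f).
    apply/measurable_EFinP; apply: continuous_measurable_row.
    exact: smooth_continuous.
  rewrite (_ : rev _ = [::]) /=; last by apply/nilP;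
    rewrite /nilp size_rev size_enum_ord.
  rewrite integral_dirac.
  - rewrite diracE mem_set ?mul1e; last by case.
    by congr (f _)%:E; apply/rowP; case.
  - exact: measurable_obox.
  - exact: measurable_funTS.
set b := t 0 ord0; pose t' : 'rV[R]_n := \row_k t 0 (lift ord0 k).
have tE : t = cons_row (b, t') by exact: row_consE.
have b0 : 0 < b by exact: t0.
have t'0 : orthant t' by move=> k; rewrite mxE.
pose Psi := foldr partial f (rev (enum 'I_n.+1)).
have cPsi : continuous Psi by exact: (sf _).1.
have mPsi : measurable_fun [set: 'rV[R]_n.+1] (EFin \o Psi).
  by apply/measurable_EFinP; exact: continuous_measurable_row.
have PsiE a v : Psi (cons_row (a, v)) =
    foldr partial (fun v => partial ord0 f (cons_row (a, v))) (rev (enum 'I_n))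
      v.
  by rewrite foldr_partial_cons_row /Psi enum_ordSl rev_cons foldr_rcons
    -map_rev.
have iPsi : (@lebesgue_row R n.+1).-integrable (obox (fun=> 0%R) (t 0))
  (EFin \o Psi).
  by apply: continuous_obox_integrable => // k; exact: ltW.
pose D' : set ('rV[R]_n) := obox (fun=> 0%R) (t' 0).
have mD' : measurable D' by exact: measurable_obox.
have consD : @cons_row R n @^-1` obox (fun=> 0%R) (t 0) = `]0%R, b] `*` D'.
  rewrite obox_cons; congr (_ `*` _); apply/seteqP.
  by split => x xt k; move: (xt k); rewrite mxE.
transitivity (\int[leb \x @lebesgue_row R n]_(p in `]0%R, b] `*` D')
  (Psi (cons_row p))%:E)%E.
  rewrite -consD (integral_lebesgue_rowS (f := EFin \o Psi))//.
  exact: measurable_obox.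
have mX : measurable (`]0%R, b] `*` D' :
  set (measurableTypeR R * 'rV[R]_n)%type).
  exact: measurableX.
have mPc : measurable_fun [set: measurableTypeR R * 'rV[R]_n]
  (fun p => (Psi (cons_row p))%:E).
  apply: (measurableT_comp (f := EFin \o Psi)) => //;
    exact: measurable_cons_row.
rewrite integral_mkcond
  -(integral12_prod_meas1 (m1 := leb) (m2 := @lebesgue_row R n)).
  rewrite /fubini_F.
  transitivity (\int[leb]_(a in `]0%R, b])
    (partial ord0 f (cons_row (a, t')))%:E)%E.
    rewrite [RHS]integral_mkcond; apply: eq_integral => a _.
    rewrite patchE; case: ifPn => [/set_mem ab|/negP nab].
      transitivity (\int[@lebesgue_row R n]_(v in D')
        (foldr partial (fun v => partial ord0 f (cons_row (a, v)))
          (rev (enum 'I_n)) v)%:E)%E.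
        rewrite [RHS]integral_mkcond; apply: eq_integral => v _.
        rewrite !patchE; case: (boolP (v \in D')) => [/set_mem vD|/negP nvD].
          by rewrite mem_set//= PsiE.
        by rewrite memNset// => -[_ /mem_set].
      apply: IH => //; first by apply: smooth_cons_row; exact: smooth_partial.
      (* the first partial derivative vanishes where another coordinate does:
         its difference quotients involve only points sharing that coordinate *)
      move=> v k vk0; rewrite /partial /derive.
      rewrite (_ : (fun h => _) = fun=> 0); first exact: lim_cst.
      apply/funext => h /=;
        rewrite -cons_row_shiftl !(f0 _ (lift ord0 k)) ?cons_rowS//.
      by rewrite subr0 scaler0.
    by rewrite integral0_eq// => v _;
      rewrite patchE memNset// => -[/= /mem_set].
  rewrite integral_partial0// (f0 (cons_row (0, t')) ord0) ?cons_row0// sube0.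
  by rewrite -tE.
apply/integrable_restrict => //; rewrite setTI -consD.
apply: (integrable_lebesgue_rowS (f := EFin \o Psi)) => //.
exact: measurable_obox.
Qed.

End mixed_partial.

(** * Positive and negative variations are measures *)

Section boxes.
Context {R : realType} {d : nat}.
Local Notation V := 'rV[R]_d.

(** A compact exhaustion of the orthant by Borel sets. *)
Definition cbox (N : nat) : set V :=
  [set x | forall k, N.+1%:R^-1 <= x 0 k <= N.+1%:R].

Lemma cbox_orthant N : cbox N `<=` orthant.
Proof. by move=> x xN k; have /andP[+ _] := xN k; apply: lt_le_trans. Qed.

Lemma cbox_itv N :
  cbox N = [set x : V | forall k, `[N.+1%:R^-1, N.+1%:R]%classic (x 0 k)].
Proof. by apply/seteqP; split => x /= xk k; move: (xk k); rewrite in_itv. Qed.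

Lemma measurable_cbox N : measurable (cbox N).
Proof.
rewrite cbox_itv.
by apply: (measurable_coordwise (A := fun=> `[N.+1%:R^-1, N.+1%:R]%classic)).
Qed.

Lemma compact_cbox N : compact (cbox N).
Proof.
rewrite cbox_itv.
have := @rV_compact R d (fun=> `[N.+1%:R^-1, N.+1%:R]%classic).
by apply => _; exact: segment_compact.
Qed.

Lemma bounded_borel_cbox N : bounded_borel (cbox N).
Proof.
split; first exact: measurable_cbox.
by exists (cbox N); split => //; [exact: compact_cbox|exact: cbox_orthant].
Qed.

(** Near each point x of the orthant the coordinates stay between x_k/2 and
   3 x_k/2, so the inclusion in a large box holds locally, and compactness makes
   it uniform. *)
Lemma compact_sub_cbox (K : set V) : compact K -> K `<=` orthant ->
  exists N, K `<=` cbox N.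
Proof.
move=> /compact_near_coveringP cK K0.
suff : \forall N \near \oo, K `<=` cbox N by case=> N _ /(_ N (leqnn _));
  exists N.
apply: (cK _ _ (fun N x => cbox N x)) => x /K0 x0.
near=> y N.
have yP : forall j, `|x 0 j - y 0 j| < x 0 j / 2.
  near: y; apply: filter_forall => j.
  have e0 : 0 < x 0 j / 2 by rewrite divr_gt0.
  have := @cvgr_dist_lt R R^o V (nbhs x) _ (fun y : V => y 0 j) (x 0 j)
    (@coord_continuous R 1 d 0 j x) _ e0.
  exact.
have xl : forall j, N.+1%:R^-1 < x 0 j / 2.
  near: N; apply: filter_forall => j.
  have e0 : 0 < x 0 j / 2 by rewrite divr_gt0.
  exact: (near_infty_natSinv_lt (PosNum e0)).
have xu : forall j, x 0 j + x 0 j / 2 <= N.+1%:R.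
  near: N; apply: filter_forall => j; near=> N.
  by rewrite (@le_trans _ _ N%:R)// ?ler_nat//; near: N; exact: nbhs_infty_ger.
move=> k; have := yP k; rewrite ltr_distlC => /andP[yl yu].
apply/andP; split; last by rewrite (le_trans (ltW yu)).
rewrite (le_trans (ltW (xl k)))// (le_trans _ (ltW yl))//.
by rewrite [X in _ <= X - _](splitr (x 0 k)) addrK.
Unshelve. all: by end_near. Qed.

Lemma bigcup_cbox : \bigcup_N cbox N = @orthant R d.
Proof.
apply/seteqP; split => [x [N _]|x x0]; first exact: cbox_orthant.
have [N xN] : exists N, [set x] `<=` cbox N.
  by apply: compact_sub_cbox; [exact: compact_set1|move=> _ ->].
by exists N => //; exact: xN.
Qed.

Lemma bounded_borelW (A B : set V) :
  measurable A -> A `<=` B -> bounded_borel B -> bounded_borel A.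
Proof. by move=> mA AB [mB [K [cK K0 BK]]]; split => //; exists K; split => //;
  exact: subset_trans BK. Qed.

Lemma bounded_borelU (A B : set V) : bounded_borel A -> bounded_borel B ->
  bounded_borel (A `|` B).
Proof.
move=> [mA [K [cK K0 AK]]] [mB [L [cL L0 BL]]]; split; first exact: measurableU.
exists (K `|` L); split; first exact: compactU.
  by move=> x [/K0|/L0].
by move=> x [/AK|/BL]; [left|right].
Qed.

Lemma bounded_borel0 : bounded_borel (set0 : set V).
Proof. by apply: bounded_borelW (bounded_borel_cbox 0). Qed.

Lemma bounded_borel_orthant (B : set V) : bounded_borel B -> B `<=` orthant.
Proof. by move=> [_ [K [_ K0 BK]]]; exact: subset_trans K0. Qed.

End boxes.

Section variation.
Context {R : realType} {d : nat}.
Local Notation V := 'rV[R]_d.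
Implicit Types (nu : set V -> R) (A B C : set V).

(** A real set function whose values matter only on relatively compact Borel
   subsets of the orthant.  The real and imaginary parts of a complex Radon
   measure have this form, and so do their opposites, hence what is proved of
   positive variations holds of negative ones. *)
Record local_charge nu : Prop := LocalCharge {
  local_charge_sigma_additive : forall F : nat -> set V,
    (forall i, measurable (F i)) -> trivIset setT F ->
    bounded_borel (\bigcup_i F i) ->
    (\sum_(i < n) nu (F i)) @[n --> \oo] --> nu (\bigcup_i F i) ;
  local_charge_bounded : forall B, bounded_borel B ->
    exists M : R, forall C, bounded_borel C -> C `<=` B -> `|nu C| <= M }.

Lemma local_chargeN nu : local_charge nu -> local_charge (fun B => - nu B).
Proof.
move=> [sa bd]; split=> [F mF tF bF|B /bd[M h]]; last first.
  by exists M => C bC CB; rewrite normrN; exact: h.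
under eq_fun do rewrite sumrN.
by apply: cvgN; exact: sa.
Qed.

Section one_charge.
Variable nu : set V -> R.
Hypothesis hnu : local_charge nu.

(** The partial sums of the constant sequence of empty sets are the multiples
   of nu set0; they converge only if nu set0 = 0. *)
Lemma local_charge0 : nu set0 = 0.
Proof.
have := @local_charge_sigma_additive _ hnu (fun=> set0) (fun=> measurable0).
rewrite bigcup0// => /(_ _ bounded_borel0) h.
have {}h : \sum_(i < n) nu set0 @[n --> \oo] --> nu set0.
  by apply: h; apply/trivIsetP => i j _ _ _; rewrite set0I.
have h1 : \sum_(i < n.+1) nu set0 @[n --> \oo] --> nu set0.
  by move: h; rewrite -(cvg_shiftS (fun n => \sum_(i < n) nu set0)).
have h2 : \sum_(i < n.+1) nu set0 @[n --> \oo] --> nu set0 + nu set0.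
  under eq_fun do rewrite big_ord_recr /=.
  by apply: cvgD => //; exact: cvg_cst.
have h3 : nu set0 = nu set0 + nu set0 by exact: cvg_unique h1 h2.
by apply: (@addrI _ (nu set0)); rewrite addr0.
Qed.

Lemma local_chargeU A B : bounded_borel A -> bounded_borel B ->
  A `&` B = set0 -> nu (A `|` B) = nu A + nu B.
Proof.
move=> bA bB AB.
have := @local_charge_sigma_additive _ hnu (bigcup2 A B).
rewrite bigcup2E => /(_ _ _ (bounded_borelU bA bB)) h.
have {}h : \sum_(i < n) nu (bigcup2 A B i) @[n --> \oo] --> nu (A `|` B).
  apply: h; last by rewrite -trivIset_bigcup2.
  by move=> [|[|i]] /=; [case: bA|case: bB|exact: measurable0].
have h2 : \sum_(i < n) nu (bigcup2 A B i) @[n --> \oo] --> nu A + nu B.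
  apply: cvg_near_cst; exists 2%N => // -[|[|n]]// _.
  rewrite !big_ord_recl/= big1 ?addr0// => i _.
  by rewrite local_charge0.
exact: cvg_unique h h2.
Qed.

Lemma local_chargeD A B : bounded_borel B -> measurable A -> A `<=` B ->
  nu (B `\` A) = nu B - nu A.
Proof.
move=> bB mA AB; apply/eqP; rewrite eq_sym subr_eq -local_chargeU.
- by rewrite setUC setUDr setDv setD0 (setUidr AB).
- by apply: (bounded_borelW _ _ bB); [apply: measurableD => //;
  case: bB|move=> x []].
- exact: bounded_borelW bB.
- by rewrite setIC setDE setIC -setIA setICl setI0.
Qed.

Lemma pos_variation_ub A B : bounded_borel B -> B `<=` A ->
  ((nu B)%:E <= pos_variation nu A)%E.
Proof. by move=> bB BA; apply: ereal_sup_ubound; exists B. Qed.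

Lemma pos_variation_le A x :
  (forall B, bounded_borel B -> B `<=` A -> ((nu B)%:E <= x)%E) ->
  (pos_variation nu A <= x)%E.
Proof. by move=> h; apply: ge_ereal_sup => _ [B [bB BA] <-]; exact: h. Qed.

Lemma pos_variation_ge0 A : (0 <= pos_variation nu A)%E.
Proof. by rewrite -[0%E]/(0%:E) -local_charge0;
  exact: (pos_variation_ub bounded_borel0 (@sub0set _ A)). Qed.

Lemma pos_variation0 : pos_variation nu set0 = 0%E.
Proof.
apply/eqP; rewrite eq_le pos_variation_ge0 andbT.
by apply: pos_variation_le => B _; rewrite subset0 => ->; rewrite local_charge0.
Qed.

Lemma pos_variationS A B : A `<=` B ->
    (pos_variation nu A <= pos_variation nu B)%E.
Proof.
by move=> AB; apply: pos_variation_le => C bC CA; apply: pos_variation_ub => //;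
  exact: subset_trans AB.
Qed.

Lemma pos_variation_fin B : bounded_borel B -> pos_variation nu B \is a fin_num.
Proof.
move=> bB; rewrite ge0_fin_numE ?pos_variation_ge0//.
have [M hM] := local_charge_bounded hnu bB.
apply: le_lt_trans (ltry M); apply: pos_variation_le => C bC CB.
by rewrite lee_fin (le_trans (ler_norm _))// hM.
Qed.

Lemma pos_variation_superadditive A B : A `&` B = set0 ->
  (pos_variation nu A + pos_variation nu B <= pos_variation nu (A `|` B))%E.
Proof.
move=> AB.
have h D : bounded_borel D -> D `<=` B ->
    (pos_variation nu A + (nu D)%:E <= pos_variation nu (A `|` B))%E.
  move=> bD DB; rewrite -leeBrDr//; apply: pos_variation_le => C bC CA.
  rewrite leeBrDr// -EFinD -local_chargeU//; last first.
    by apply/seteqP; split => // x [/CA Ax /DB Bx]; rewrite -AB.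
  apply: pos_variation_ub; first exact: bounded_borelU.
  exact: setUSS.
(* the second supremum can be taken only after subtracting the first *)
have [Aoo|] := eqVneq (pos_variation nu A) +oo%E.
  by rewrite (le_trans (leey _))// -Aoo; apply: pos_variationS; exact: subsetUl.
move=> Aoo; have Afin : pos_variation nu A \is a fin_num.
  by rewrite ge0_fin_numE ?pos_variation_ge0// ltey.
rewrite addeC -leeBrDr//; apply: pos_variation_le => D bD DB.
by rewrite leeBrDr// addeC; exact: h.
Qed.

(** Superadditivity bounds finite sums by the variation of the union; conversely
   the value of nu on a subset C of the union is the sum of its values on the
   pieces of C, each at most the variation of the corresponding set. *)
Lemma pos_variation_semi_sigma_additive :
  semi_sigma_additive (pos_variation nu : set V -> \bar R).
Proof.
move=> F mF tF mUF.
have cF : cvgn (fun n => \sum_(0 <= i < n) pos_variation nu (F i))%E.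
  by apply: is_cvg_nneseries => n _ _; exact: pos_variation_ge0.
suff <- : limn (fun n => \sum_(0 <= i < n) pos_variation nu (F i))%E =
  pos_variation nu (\bigcup_n F n) by [].
apply/eqP; rewrite eq_le; apply/andP; split.
  apply: lime_le => //; apply: nearW => n.
  apply: (@le_trans _ _ (pos_variation nu (\big[setU/set0]_(0 <= i < n) F i)));
    last first.
    by apply: pos_variationS; rewrite big_mkord; exact: bigsetU_bigcup.
  elim: n => [|n IH]; first by rewrite !big_nil pos_variation0.
  rewrite !big_nat_recr//= (le_trans (leeD2r _ IH))//.
  apply: pos_variation_superadditive.
  rewrite big_mkord -bigcup_mkord setI_bigcupl; apply: bigcup0 => i /= ilt.
  have /trivIsetP := tF; apply => //.
  by rewrite ltn_eqF.
apply: pos_variation_le => C bC CF.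
have CE : C = \bigcup_i (C `&` F i) by rewrite -setI_bigcupr;
  apply/esym/setIidPl.
have mC : measurable C by case: bC.
have : \sum_(i < n) nu (C `&` F i) @[n --> \oo] --> nu C.
  rewrite [X in _ --> nu X]CE; apply: local_charge_sigma_additive => //.
  - by move=> i; exact: measurableI.
  - apply/trivIsetP => i j _ _ ij; rewrite setIACA setIid.
    by have /trivIsetP/(_ i j I I ij) -> := tF; rewrite setI0.
  - by rewrite -CE.
move=> h.
have {}h : (\sum_(i < n) nu (C `&` F i))%:E @[n --> \oo] --> (nu C)%:E.
  by apply/fine_cvgP; split; [exact: nearW|].
rewrite -(cvg_lim _ h)//; apply: lee_lim => //; first by apply/cvg_ex;
  exists (nu C)%:E.
apply: nearW => n; rewrite -sumEFin big_mkord; apply: lee_sum => i _.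
apply: pos_variation_ub; last exact: subIsetr.
by apply: bounded_borelW bC => //; exact: measurableI.
Qed.

Lemma pos_variation_orthant A :
  (pos_variation nu A <= pos_variation nu (A `&` orthant))%E.
Proof.
apply: pos_variation_le => B bB BA; apply: pos_variation_ub => // x Bx.
by split; [exact: BA|exact: bounded_borel_orthant Bx].
Qed.

(** The cover that witnesses sigma-finiteness adds the complement of the orthant
   to each compact box: the variation does not charge that complement. *)
Lemma pos_variation_measure :
  exists P : {sigma_finite_measure set V -> \bar R}, pos_variation nu = P.
Proof.
pose S := isMeasure.Build _ _ _ (pos_variation nu) pos_variation0
  pos_variation_ge0
  pos_variation_semi_sigma_additive.
pose M : {measure set V -> \bar R} := HB.pack (pos_variation nu) S.
have Msf : sigma_finite setT M.
  exists (fun N => cbox N `|` ~` orthant).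
    apply/seteqP; split => // x _.
    have [|nx0] := pselect (orthant x); last by exists 0%N => //; right.
    by rewrite -bigcup_cbox => -[N _ xN]; exists N => //; left.
  move=> N; split.
    apply: measurableU; first exact: measurable_cbox.
    by apply: measurableC; exact: measurable_orthant.
  apply: le_lt_trans (pos_variation_orthant _) _.
  rewrite setIUl setICl setU0 (setIidl (@cbox_orthant _ _ N)) ltey_eq.
  by rewrite (pos_variation_fin (bounded_borel_cbox N)).
pose S' := Measure_isSigmaFinite.Build _ _ _ M Msf.
pose M' : {sigma_finite_measure set V -> \bar R} :=
  HB.pack (M : set _ -> \bar R) M S'.
by exists M'.
Qed.

End one_charge.

(** No Hahn decomposition is involved: for C inside B,
   nu C = nu B - nu (B \ C), so the supremum of nu C and that of - nu (B \ C)
   differ by nu B. *)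
Lemma pos_variation_Jordan nu B : local_charge nu -> bounded_borel B ->
  pos_variation nu B = ((nu B)%:E + neg_variation nu B)%E.
Proof.
move=> hnu bB; have hN := local_chargeN hnu.
have mB : measurable B by case: bB.
apply/eqP; rewrite eq_le; apply/andP; split.
  apply: pos_variation_le => C bC CB.
  have mC : measurable C by case: bC.
  rewrite -leeBlDl// -EFinB.
  rewrite (_ : nu C - nu B = - nu (B `\` C));
    last by rewrite local_chargeD// opprB.
  apply: pos_variation_ub => //.
  exact: (bounded_borelW (measurableD mB mC) (@subDsetl _ _ _) bB).
rewrite addeC -leeBrDr//; apply: pos_variation_le => C bC CB.
have mC : measurable C by case: bC.
rewrite leeBrDr// -EFinD addrC -(local_chargeD hnu bB)//.
apply: pos_variation_ub => //.
exact: (bounded_borelW (measurableD mB mC) (@subDsetl _ _ _) bB).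
Qed.

End variation.

(** * Real and imaginary parts of a complex Radon measure *)

Section complex_coordinate.
Context {R : realType}.

(** What the proof uses of Re and Im, so that both are treated at once. *)
Record complex_coordinate (p : R[i] -> R) : Prop := ComplexCoordinate {
  coordinate0 : p 0 = 0 ;
  coordinateD : {morph p : z w / z + w} ;
  coordinate_le : forall z, `|p z| <= Normc.normc z ;
  coordinate_cvg : forall u l, complex_cvg u l ->
    p (u n) @[n --> \oo] --> p l }.

Lemma Re_coordinate : complex_coordinate (@complex.Re R).
Proof.
split=> [|[? ?] []|[a b]|u l []]//=.
by rewrite -sqrtr_sqr ler_sqrt ?lerDl ?sqr_ge0// addr_ge0 ?sqr_ge0.
Qed.

Lemma Im_coordinate : complex_coordinate (@complex.Im R).
Proof.
split=> [|[? ?] []|[a b]|u l []]//=.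
by rewrite -sqrtr_sqr ler_sqrt ?lerDr ?sqr_ge0// addr_ge0 ?sqr_ge0.
Qed.

Lemma normc_le_ReIm (z : R[i]) : Normc.normc z <= `|Re z| + `|Im z|.
Proof.
case: z => a b /=; rewrite -[leRHS]ger0_norm ?addr_ge0// -[leRHS]sqrtr_sqr
  ler_sqrt ?sqr_ge0//.
rewrite sqrrD !real_normK ?num_real// lerD2r lerDl.
by rewrite mulrn_wge0// mulr_ge0.
Qed.

End complex_coordinate.

Section complex_variation.
Context {R : realType} {d : nat}.
Local Notation V := 'rV[R]_d.
Variable mu : set V -> R[i].
Hypothesis hmu : complex_radon mu.

Lemma bounded_borel_finite_variation B :
  bounded_borel B -> finite_variation mu B.
Proof.
move=> bB; split; [by case: bB|exact: bounded_borel_orthant|].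
case: bB => _ [K [cK K0 BK]].
apply: le_lt_trans (complex_radon_locally_finite hmu cK K0).
apply: ge_ereal_sup => _ [n [C [bC CB tC ->]]].
by apply: ereal_sup_ubound; exists n, C; split => // i; exact: subset_trans BK.
Qed.

Lemma normc_le_abs_variation A B : bounded_borel B -> B `<=` A ->
  ((Normc.normc (mu B))%:E <= abs_variation mu A)%E.
Proof.
move=> bB BA; apply: ereal_sup_ubound; exists 1%N, (fun=> B); split => //.
- by apply/trivIsetP => i j _ _; rewrite !ord1 eqxx.
- by rewrite big_ord1.
Qed.

Section coordinate.
Variable p : R[i] -> R.
Hypothesis hp : complex_coordinate p.

Let nu B := p (mu B).

Let p_sum n (F : 'I_n -> R[i]) : p (\sum_(i < n) F i) = \sum_(i < n) p (F i).
Proof. exact: (big_morph p (coordinateD hp) (coordinate0 hp)). Qed.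

Lemma coord_sigma_additive (F : nat -> set V) :
  (forall i, measurable (F i)) -> trivIset setT F ->
  finite_variation mu (\bigcup_i F i) ->
  (\sum_(i < n) nu (F i)) @[n --> \oo] --> nu (\bigcup_i F i).
Proof.
move=> mF tF fF; under eq_fun do rewrite -p_sum.
by apply: (coordinate_cvg hp); exact: complex_radon_sigma_additive.
Qed.

Lemma coord_local_charge : local_charge nu.
Proof.
split=> [F mF tF bF|B bB].
  by apply: coord_sigma_additive => //; exact: bounded_borel_finite_variation.
have [_ _ fB] := bounded_borel_finite_variation bB.
have fin : abs_variation mu B \is a fin_num.
  rewrite ge0_fin_numE//;
    apply: le_trans (normc_le_abs_variation bB (@subset_refl _ B)).
  by rewrite lee_fin (le_trans _ (coordinate_le hp _)).
exists (fine (abs_variation mu B)) => C bC CB.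
apply: le_trans (coordinate_le hp _) _.
by rewrite -lee_fin fineK// normc_le_abs_variation.
Qed.

Lemma pos_variation_le_abs A : (pos_variation nu A <= abs_variation mu A)%E.
Proof.
apply: pos_variation_le => B bB BA;
  apply: le_trans (normc_le_abs_variation bB BA).
by rewrite lee_fin (le_trans (ler_norm _) (coordinate_le hp _)).
Qed.

Lemma neg_variation_le_abs A : (neg_variation nu A <= abs_variation mu A)%E.
Proof.
apply: pos_variation_le => B bB BA;
  apply: le_trans (normc_le_abs_variation bB BA).
by rewrite lee_fin (le_trans (ler_norm _))// normrN coordinate_le.
Qed.

(** The identity holds on relatively compact sets; an arbitrary set of finite
   variation is a countable disjoint union of such sets, and both sides are
   countably additive along it. *)
Lemma coord_finite_variation A : finite_variation mu A ->
  [/\ pos_variation nu A \is a fin_num, neg_variation nu A \is a fin_num &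
      nu A = fine (pos_variation nu A) - fine (neg_variation nu A)].
Proof.
have hnu := coord_local_charge; have hN := local_chargeN hnu.
move=> [mA A0 fA].
have fP : pos_variation nu A \is a fin_num.
  by rewrite ge0_fin_numE ?(le_lt_trans (pos_variation_le_abs A))//
    pos_variation_ge0.
have fN : neg_variation nu A \is a fin_num.
  by rewrite ge0_fin_numE ?(le_lt_trans (neg_variation_le_abs A))//
    (pos_variation_ge0 hN).
split => //.
pose F := seqDU (fun N => A `&` cbox N).
have FA : \bigcup_N F N = A.
  by rewrite -seqDU_bigcup_eq -setI_bigcupr bigcup_cbox; apply/setIidPl.
have mF N : measurable (F N).
  apply: measurableD; first exact: measurableI (measurable_cbox N).
  by apply: bigsetU_measurable => i _; exact: measurableI (measurable_cbox i).
have bF N : bounded_borel (F N).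
  apply: (bounded_borelW _ _ (bounded_borel_cbox N)) => //.
  by move=> x [[]].
have tF : trivIset setT F by exact: trivIset_seqDU.
have h1 : (\sum_(i < n) nu (F i)) @[n --> \oo] --> nu A.
  rewrite -[X in _ --> nu X]FA; apply: coord_sigma_additive => //.
  by rewrite FA.
have h2 m : local_charge m -> pos_variation m A \is a fin_num ->
    (\sum_(i < n) fine (pos_variation m (F i))) @[n --> \oo] -->
      fine (pos_variation m A).
  move=> hm fm.
  have fmF i : pos_variation m (F i) \is a fin_num by exact: pos_variation_fin.
  have := pos_variation_semi_sigma_additive hm mF tF.
  rewrite FA => /(_ mA) h.
  have -> : (fun n => \sum_(i < n) fine (pos_variation m (F i))) =
      fine \o (fun n => \sum_(0 <= i < n) pos_variation m (F i))%E.
    apply/funext => n /=; rewrite big_mkord.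
    by under [in RHS]eq_bigr do rewrite -(fineK (fmF _)); rewrite sumEFin.
  by apply: fine_cvg; rewrite fineK.
have h3 : (\sum_(i < n) nu (F i)) @[n --> \oo] -->
    fine (pos_variation nu A) - fine (neg_variation nu A).
  have -> : (fun n => \sum_(i < n) nu (F i)) =
      (fun n => \sum_(i < n) fine (pos_variation nu (F i)) -
                \sum_(i < n) fine (neg_variation nu (F i))).
    apply/funext => n; rewrite -sumrB; apply: eq_bigr => i _.
    rewrite (pos_variation_Jordan hnu (bF i)) fineD//.
      by rewrite addrK.
    exact: (pos_variation_fin hN).
  by apply: cvgB; exact: h2.
exact: cvg_unique h1 h3.
Qed.

End coordinate.

End complex_variation.

(** * Integrals against set functions and null sets *)

Section integral_set_function.
Local Open Scope ereal_scope.
Context d (T : measurableType d) (R : realType).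
Import HBNNSimple.

Let sintegral_range (phi : set T -> \bar R) (h : {nnsfun T >-> R}) :
  phi set0 = 0 ->
  sintegral phi h = \sum_(x \in range h) x%:E * phi (h @^-1` [set x]).
Proof.
move=> phi0; rewrite sintegralET (fsbig_widen (range h) setT)//= => x.
move=> [_ Nhx] /=.
by rewrite preimage10// phi0 mule0.
Qed.

(** The dominating integral is the one in the integrability condition on the
   total variation.  For a positive function the integral is a supremum over
   simple functions, which is monotone in the set function, be it a measure or
   not. *)
Lemma ge0_le_integral_set_function (m : {measure set T -> \bar R})
    (phi : set T -> \bar R) D (f : T -> \bar R) :
  phi set0 = 0 -> (forall A, m A <= phi A) -> (forall x, D x -> 0 <= f x) ->
  \int[m]_(x in D) f x <= \int[phi]_(x in D) f x.
Proof.
move=> phi0 mphi f0; rewrite /integral.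
have -> : (f \_ D)^\+ = f \_ D.
  by apply/funext => x; rewrite funeposE patchE;
    case: ifPn => [/set_mem/f0 ?|_]; apply/max_idPl.
have -> : (f \_ D)^\- = cst 0.
  apply/funext => x; rewrite funenegE patchE; case: ifPn => [/set_mem/f0 ?|_];
    apply/max_idPr => //=.
  by rewrite oppe_le0.
have -> : ereal_sup [set sintegral phi h | h in
    [set h : {nnsfun T >-> R} | forall x, (h x)%:E <= cst 0 x]] = 0.
  have sphi0 (h : {nnsfun T >-> R}) : (forall x, (h x)%:E <= 0) ->
    sintegral phi h = 0.
    move=> h0; rewrite sintegral_range// fsbig1// => r [x _ <-].
    have -> : h x = 0%R by apply/le_anti; rewrite -lee_fin h0 /=.
    by rewrite mul0e.
  apply/eqP; rewrite eq_le; apply/andP; split.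
    by apply: ge_ereal_sup => _ [h h0 <-]; rewrite sphi0.
  apply: ereal_sup_ubound; exists nnsfun0 => //.
  exact: sphi0.
rewrite sube0; apply: (@le_trans _ _ (ereal_sup [set sintegral m h | h in
    [set h : {nnsfun T >-> R} | forall x, (h x)%:E <= (f \_ D) x]])).
  rewrite geeDl// oppe_le0; apply: ereal_sup_ubound; exists nnsfun0 => //.
  exact: sintegral0.
apply: ge_ereal_sup => _ [h hf <-]; apply: le_ereal_sup_tmp.
exists (sintegral phi h); first by exists h.
rewrite !sintegral_range//; apply: lee_fsum => // r [x _ <-].
by rewrite lee_wpmul2l// lee_fin.
Qed.

(** No measurability is assumed on f and g: a density that is only Lebesgue
   measurable need not be Borel measurable.  A simple function below f becomes
   one below g, of the same integral, when it is set to 0 on the null set N. *)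
Lemma ae_eq_integral_set (m : {measure set T -> \bar R}) (D N : set T)
    (f g : T -> \bar R) :
  measurable N -> m N = 0 -> (forall x, D x -> ~ N x -> f x = g x) ->
  \int[m]_(x in D) f x = \int[m]_(x in D) g x.
Proof.
move=> mN N0 fg.
have le (u v : T -> \bar R) : (forall x, 0 <= v x) ->
  (forall x, ~ N x -> u x = v x) ->
  ereal_sup [set sintegral m h | h in
    [set h : {nnsfun T >-> R} | forall x, (h x)%:E <= u x]] <=
  ereal_sup [set sintegral m h | h in
    [set h : {nnsfun T >-> R} | forall x, (h x)%:E <= v x]].
  move=> v0 uv; apply: ge_ereal_sup => _ [h hu <-]; apply: ereal_sup_ubound.
  have mNC := measurableC mN.
  exists (proj_nnsfun h mNC).
    move=> x /=; rewrite mindicE; case: (boolP (x \in ~` N)) => [/set_mem xN|_].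
      by rewrite mulr1 -uv.
    by rewrite mulr0.
  have E (k : {nnsfun T >-> R}) : sintegral m k = \int[m]_(x in ~` N) (k x)%:E.
    transitivity (\int[m]_x (k x)%:E);
      first by rewrite integral_nnsfun// patch_setT.
    rewrite (ge0_negligible_integral mN)//.
    - by rewrite setTD.
    - exact/measurable_EFinP.
    - by move=> x _; rewrite lee_fin.
  rewrite !E; apply: eq_integral => x /set_mem xN /=.
  by rewrite mindicE mem_set// mulr1.
have eq (u v : T -> \bar R) : (forall x, 0 <= u x) -> (forall x, 0 <= v x) ->
    (forall x, ~ N x -> u x = v x) ->
  ereal_sup [set sintegral m h | h in
    [set h : {nnsfun T >-> R} | forall x, (h x)%:E <= u x]] =
  ereal_sup [set sintegral m h | h in
    [set h : {nnsfun T >-> R} | forall x, (h x)%:E <= v x]].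
  move=> u0 v0 uv; apply/eqP; rewrite eq_le !le// => x Nx.
  by rewrite uv.
have fgD x : ~ N x -> (f \_ D) x = (g \_ D) x.
  by move=> Nx; rewrite !patchE; case: ifPn => // /set_mem Dx; exact: fg.
rewrite /integral; congr (_ - _); apply: eq => // x Nx.
- by rewrite !funeposE fgD.
- by rewrite !funenegE fgD.
Qed.

End integral_set_function.

(** * Exchanging the tail integral with the test function *)

Section support.
Context {R : realType} {d : nat}.
Local Notation V := 'rV[R]_d.

Lemma partial_support (C : set V) (f : V -> R) k : closed C ->
  (forall x, ~ C x -> f x = 0) -> forall x, ~ C x -> partial k f x = 0.
Proof.
move=> cC f0 x Cx; rewrite /partial /derive; apply: lim_near_cst => //.
have oC : nbhs x (~` C) by apply: open_nbhs_nbhs; split => //;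
  exact: closed_openC.
have h0 : (fun h : R => h *: delta_mx 0 k + x : V) @ 0^' -->
  (0 *: delta_mx 0 k + x : V).
  apply: cvg_within_filter.
  apply: cvgD; last exact: cvg_cst.
  apply: cvgZr_tmp; exact: cvg_id.
rewrite scale0r add0r in h0.
have hC : \forall h \near (0 : R)^', ~ C (h *: delta_mx 0 k + x)
  by exact: (h0 _ oC).
apply: filterS hC => h /= hC.
by rewrite f0// f0// subr0 scaler0.
Qed.

Lemma foldr_partial_support (C : set V) (f : V -> R) s : closed C ->
  (forall x, ~ C x -> f x = 0) -> forall x, ~ C x -> foldr partial f s x = 0.
Proof. by move=> cC f0; elim: s => //= k s IH x Cx;
  apply: (partial_support (C := C)). Qed.

End support.

Definition tail_integrable {R : realType} {d} (phi : set 'rV[R]_d -> \bar R) :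
    Prop :=
  forall r : 'rV[R]_d, orthant r ->
  (\int[phi]_(t in orthant) (\prod_(k < d) Num.min (r 0 k) (t 0 k))%:E < +oo)%E.

Section tail_fubini.
Context {R : realType} {d : nat}.
Local Notation V := 'rV[R]_d.
Local Notation leb := (@lebesgue_row R d).
Variable m : {sigma_finite_measure set V -> \bar R}.
Hypothesis mfin : tail_integrable m.

Lemma measurable_prod_min (r : V) (D : set V) :
  measurable_fun D (fun t : V => (\prod_(k < d) Num.min (r 0 k) (t 0 k))%:E).
Proof.
apply: measurable_funTS.
apply/measurable_EFinP; apply: measurable_prod => k _.
by apply: measurable_minr => //; exact: measurable_row_coord.
Qed.

Lemma prod_min_ge0 (r t : V) : orthant r -> orthant t ->
  0 <= \prod_(k < d) Num.min (r 0 k) (t 0 k).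
Proof. by move=> r0 t0; apply: prodr_ge0 => k _; rewrite le_min !ltW. Qed.

Lemma orthant_upper_set (x : V) : orthant x -> upper_set x `<=` orthant.
Proof. by move=> x0 t xt k; exact: lt_le_trans (xt k). Qed.

(** On the upper set of x the product of the minima equals the product of the
   x_k, hence Markov's inequality bounds the tail at x. *)
Lemma tail_fin (x : V) : orthant x -> m (upper_set x) \is a fin_num.
Proof.
move=> x0; rewrite ge0_fin_numE//.
have p0 : 0 < \prod_(k < d) x 0 k by apply: prodr_gt0 => k _; exact: x0.
have : ((\prod_(k < d) x 0 k)%:E * m (upper_set x) < +oo)%E.
  apply: le_lt_trans (mfin x0).
  rewrite -integral_cst; last exact: measurable_upper_set.
  apply: (@le_trans _ _
    (\int[m]_(t in upper_set x) (\prod_(k < d) Num.min (x 0 k) (t 0 k))%:E)%E).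
    rewrite le_eqVlt; apply/orP; left; apply/eqP;
      apply: eq_integral => t /set_mem xt /=.
    by congr (_%:E); apply: eq_bigr => k _; rewrite min_l.
  apply: ge0_subset_integral => //;
    [exact: measurable_upper_set|exact: measurable_orthant| | |].
  - exact: measurable_prod_min.
  - by move=> t t0; rewrite lee_fin prod_min_ge0.
  - exact: orthant_upper_set.
rewrite [X in _ -> is_true X]ltey; apply: contraTN => /eqP ->.
by rewrite gt0_muley ?lte_fin.
Qed.

(** The domain over which the order of integration is exchanged. *)
Definition below : set (V * V) := [set p | orthant p.1 /\ upper_set p.1 p.2].

Lemma measurable_below : measurable below.
Proof.
rewrite (_ : below = fst @^-1` orthant `&`
  \bigcap_(k in [set: 'I_d]) [set p : V * V | p.1 0 k <= p.2 0 k]).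
  apply: measurableI.
    rewrite -[X in measurable X]setTI; apply: measurable_fst => //;
      exact: measurable_orthant.
  apply: fin_bigcap_measurable => // k _.
  rewrite -[X in measurable X]setTI.
  apply: (@measurable_fun_ler _ _ R setT (fun p : V * V => p.1 0 k)
    (fun p : V * V => p.2 0 k) _ _ _ [set true]) => //.
    by apply: (measurableT_comp (f := fun x : V => x 0 k)) => //;
      exact: measurable_row_coord.
  by apply: (measurableT_comp (f := fun x : V => x 0 k)) => //;
    exact: measurable_row_coord.
apply/seteqP; split => -[x t] /=; first by case=> x0 xt; split => // k _;
  exact: xt.
by case=> x0 xt; split => // k; exact: xt.
Qed.

Section test.
Variables (f : V -> R) (N : nat).
Hypotheses (sf : smooth f) (fN : forall x, ~ cbox N x -> f x = 0).
Let Psi := foldr partial f (rev (enum 'I_d)).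
Let H := ((fun p : V * V => (Psi p.1)%:E) \_ below).

Let cPsi : continuous Psi. Proof. exact: (sf _).1. Qed.

Let PsiN x : ~ cbox N x -> Psi x = 0.
Proof.
apply: foldr_partial_support => //.
by apply: compact_closed; [exact: norm_hausdorff|exact: compact_cbox].
Qed.

Let mH : measurable_fun setT H.
Proof.
apply/measurable_restrict => //; first exact: measurable_below.
rewrite setTI; apply: measurable_funTS; apply/measurable_EFinP.
apply: measurableT_comp => //; exact: continuous_measurable_row.
Qed.

Let PsiB : exists2 M : R, 0 <= M & forall x, `|Psi x| <= M.
Proof.
have : bounded_set (Psi @` cbox N).
  apply: compact_bounded; apply: continuous_compact; last exact: compact_cbox.
  exact: continuous_subspaceT.
case=> M0 [_ hM]; exists (`|M0| + 1); first by rewrite addr_ge0.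
move=> x; have [xN|xN] := pselect (cbox N x);
  last by rewrite PsiN// normr0 addr_ge0.
apply: (hM (`|M0| + 1)); last by exists x.
by rewrite (le_lt_trans (ler_norm _))// ltrDl.
Qed.

Let HE x t : H (x, t) = ((EFin \o Psi) \_ (obox (fun=> 0%R) (t ord0))) x.
Proof.
rewrite /H !patchE; congr (if _ then _ else _).
apply/idP/idP => /set_mem.
  by case=> x0 xt; apply/mem_set => k; rewrite x0 xt.
by move=> xt; apply/mem_set; split => k; have /andP[] := xt k.
Qed.

Let f0 x : ~ orthant x -> f x = 0.
Proof. by move=> x0; apply: fN => /cbox_orthant. Qed.

Let sec_t t : (\int[leb]_x H (x, t) = (f t)%:E)%E.
Proof.
under eq_integral do rewrite HE.
rewrite -integral_mkcond; have [t0|t0] := pselect (orthant t).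
  apply: integral_obox_mixed_partial => // x k xk0.
  by apply: f0 => /(_ k); rewrite xk0 ltxx.
rewrite f0// (_ : obox _ _ = set0) ?integral_set0//.
apply/seteqP; split => // x xt; apply: t0 => k.
by have /andP[] := xt k; exact: lt_le_trans.
Qed.

Let sec_x x : (\int[m]_t H (x, t) =
  ((fun x => (fine (m (upper_set x)) * Psi x)%:E) \_ orthant) x)%E.
Proof.
rewrite patchE; case: ifPn => [/set_mem x0|/negP x0].
  transitivity (\int[m]_(t in upper_set x) (cst (Psi x)%:E t))%E.
    rewrite [RHS]integral_mkcond; apply: eq_integral => t _.
    rewrite /H !patchE; congr (if _ then _ else _).
    by apply/idP/idP => /set_mem; [case=> _ ?|]; rewrite inE.
  rewrite integral_cst; last exact: measurable_upper_set.
  by rewrite mulrC EFinM fineK// tail_fin.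
rewrite integral0_eq// => t _; rewrite /H patchE memNset// => -[/mem_set//].
Qed.

Let r : V := const_mx N.+1%:R.

Let sec_abs M t : 0 <= M -> (forall x, `|Psi x| <= M) ->
  (\int[leb]_x `|H (x, t)| <=
   ((fun t => M%:E * (\prod_(k < d) Num.min (r ord0 k) (t ord0 k))%:E) \_
     orthant) t)%E.
Proof.
move=> M0 PsiM; rewrite patchE; case: ifPn => [/set_mem t0|/negP t0];
  last first.
  rewrite integral0_eq// => x _;
    rewrite /H patchE memNset ?abse0// => -[/= x0 xt].
  by apply: t0; apply/mem_set => k; exact: lt_le_trans (xt k).
pose b k := Num.min (r ord0 k) (t ord0 k).
have b0 k : 0 <= b k by rewrite le_min mxE ler0n ltW.
(* the product of the minima is the volume of the box (0, min(r, t)] *)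
have -> : \prod_(k < d) b k = \prod_(k < d) (b k - 0).
  by apply: eq_bigr => k _; rewrite subr0.
have mb : measurable (obox (fun=> 0) b) by exact: measurable_obox.
rewrite -(@lebesgue_row_obox _ _ (fun=> 0) b)// -integral_cst//.
rewrite [leRHS]integral_mkcond; apply: ge0_le_integral => //.
- apply: measurableT_comp => //.
  by apply: (measurableT_comp mH); exact: measurable_pair2.
- by apply/measurable_restrict => //.
move=> x _; rewrite HE !patchE.
case: ifPn => [/set_mem xt|_]; last by rewrite abse0; case: ifP.
have [xN|xN] := pselect (cbox N x); last by rewrite /= PsiN// normr0; case: ifP.
rewrite mem_set/= ?lee_fin// => k.
have /andP[x0 xtk] := xt k; have /andP[_ xNk] := xN k.
by rewrite x0 le_min mxE xNk.
Qed.

(** Psi is bounded by some M and vanishes beyond r = (N+1, ..., N+1), so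
   the absolute double integral is at most M times the integral of the product
   of the min(r_k, t_k) against m, which is finite. *)
Let iH : (leb \x m)%E.-integrable setT H.
Proof.
have [M M0 PsiM] := PsiB.
apply/integrable21ltyP => //.
have r0 : orthant r by move=> k; rewrite mxE ltr0n.
apply: (@le_lt_trans _ _ (\int[m]_(t in orthant)
    (M%:E * (\prod_(k < d) Num.min (r ord0 k) (t ord0 k))%:E))%E).
  rewrite [leRHS]integral_mkcond; apply: ge0_le_integral => //.
  - by move=> t _; apply: integral_ge0.
  - apply: (measurable_fun_fubini_tonelli_G (fun p => `|H p|%E)) => //.
    exact: measurableT_comp.
  - apply/measurable_restrict => //; first exact: measurable_orthant.
    rewrite setTI; apply: emeasurable_funM => //.
    exact: measurable_prod_min.
  - by move=> t _; exact: sec_abs.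
rewrite ge0_integralZl_EFin//.
- by rewrite lte_mul_pinfty ?lee_fin// mfin.
- exact: measurable_orthant.
- by move=> t t0; rewrite lee_fin prod_min_ge0.
- exact: measurable_prod_min.
Qed.

Lemma integrable_tail_mixed_partial : leb.-integrable orthant
  (fun x => (fine (m (upper_set x)) * Psi x)%:E).
Proof.
rewrite -[X in integrable _ X](setTI orthant); apply/integrable_restrict => //.
  exact: measurable_orthant.
have := integrable_fubini_F iH; rewrite /fubini_F.
by under eq_fun do rewrite sec_x.
Qed.

(** Integrating Psi 1_(0 < x <= t) in t first gives Psi(x) times the tail at x;
   integrating it in x first gives f t by the iterated fundamental theorem. *)
Lemma integral_tail_mixed_partial :
  (\int[m]_(t in orthant) (f t)%:E =
   \int[leb]_(x in orthant) (fine (m (upper_set x)) * Psi x)%:E)%E.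
Proof.
rewrite [RHS]integral_mkcond.
transitivity (\int[leb]_x \int[m]_t H (x, t))%E; last first.
  by apply: eq_integral => x _; rewrite sec_x.
rewrite [RHS](integral12_prod_meas1 iH) -(integral21_prod_meas1 iH) /fubini_G.
under [in RHS]eq_integral do rewrite sec_t.
rewrite [LHS]integral_mkcond; apply: eq_integral => t _; rewrite patchE.
by case: ifPn => // /negP t0; rewrite f0// => /mem_set.
Qed.

End test.

End tail_fubini.

(** * The distributional identity *)

Lemma sum_le_measure d (T : measurableType d) (R : realType)
    (m : {measure set T -> \bar R}) n (B : 'I_n -> set T) A :
  (forall i, measurable (B i)) -> measurable A -> (forall i, B i `<=` A) ->
  trivIset setT B -> (\sum_(i < n) m (B i) <= m A)%E.
Proof.
move=> mB mA BA tB; rewrite -measure_bigsetU_ord//; apply: le_measure;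
  rewrite ?inE//.
  exact: bigsetU_measurable.
apply: (big_ind (fun X : set T => X `<=` A)) => // X Y XA YA x [/XA|/YA]//.
Qed.

Section tail_potential.
Context {R : realType} {d : nat}.
Local Notation V := 'rV[R]_d.
Local Notation leb := (@lebesgue_row R d).
Variable mu : set V -> R[i].
Hypothesis hmu : complex_radon mu.
Hypothesis mu_int : tail_integrable (abs_variation mu).

Lemma complex_radon0 : mu set0 = 0.
Proof.
have := local_charge0 (coord_local_charge hmu (@Re_coordinate R)).
have := local_charge0 (coord_local_charge hmu (@Im_coordinate R)).
by case: (mu set0) => a b /= -> ->.
Qed.

Lemma abs_variation0 : abs_variation mu set0 = 0%E.
Proof.
apply/eqP; rewrite eq_le; apply/andP; split.
  apply: ge_ereal_sup => _ [n [B [_ B0 _ ->]]].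
  rewrite big1// => i _; have /= := B0 i; rewrite subset0 => ->.
  by rewrite complex_radon0 Normc.normc0.
have := normc_le_abs_variation mu bounded_borel0 (@subset_refl _ set0).
by rewrite complex_radon0 Normc.normc0.
Qed.

Lemma tail_integrable_variation (m : {sigma_finite_measure set V -> \bar R}) :
  (forall A, (m A <= abs_variation mu A)%E) -> tail_integrable m.
Proof.
move=> m_le r r0; apply: le_lt_trans (mu_int r0).
apply: ge0_le_integral_set_function => //; first exact: abs_variation0.
by move=> t t0; rewrite lee_fin prod_min_ge0.
Qed.

Lemma coord_variation_measures p : complex_coordinate p ->
  exists P M : {sigma_finite_measure set V -> \bar R},
  [/\ pos_variation (fun B => p (mu B)) = P,
      neg_variation (fun B => p (mu B)) = M,
      forall A, (P A <= abs_variation mu A)%E &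
      forall A, (M A <= abs_variation mu A)%E].
Proof.
move=> hp; have hnu := coord_local_charge hmu hp.
have [P PE] := pos_variation_measure hnu.
have [M ME] := pos_variation_measure (local_chargeN hnu).
exists P, M; split => // A; rewrite -?PE -?ME.
  exact: pos_variation_le_abs.
exact: neg_variation_le_abs.
Qed.

Lemma le_coord_variation p B : complex_coordinate p -> bounded_borel B ->
  (`|p (mu B)|%:E <= pos_variation (fun B => p (mu B)) B +
                     neg_variation (fun B => p (mu B)) B)%E.
Proof.
move=> hp bB; have hnu := coord_local_charge hmu hp;
  have hN := local_chargeN hnu.
have [pB|pB] := leP 0 (p (mu B)).
  rewrite ger0_norm// (le_trans
    (pos_variation_ub (fun B => p (mu B)) bB (@subset_refl _ B)))//.
  by rewrite leeDl// (pos_variation_ge0 hN).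
rewrite ltr0_norm// (le_trans
  (pos_variation_ub (fun B => - p (mu B)) bB (@subset_refl _ B)))//.
by rewrite leeDr// (pos_variation_ge0 hnu).
Qed.

(** The total variation is at most the sum of the positive and negative
   variations of both coordinates, and each of these has finite tails. *)
Lemma finite_variation_upper_set (x : V) :
  orthant x -> finite_variation mu (upper_set x).
Proof.
move=> x0; split; [exact: measurable_upper_set|exact: orthant_upper_set|].
have [P1 [N1 [P1E N1E hP1 hN1]]] := coord_variation_measures (@Re_coordinate R).
have [P2 [N2 [P2E N2E hP2 hN2]]] := coord_variation_measures (@Im_coordinate R).
have fin (m : {sigma_finite_measure set V -> \bar R}) :
    (forall A, (m A <= abs_variation mu A)%E) -> (m (upper_set x) < +oo)%E.
  by move=> /tail_integrable_variation h; rewrite ltey_eq (tail_fin h).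
apply: (@le_lt_trans _ _ ((P1 (upper_set x) + N1 (upper_set x)) +
  (P2 (upper_set x) + N2 (upper_set x)))%E);
    last by rewrite !lte_add_pinfty ?fin.
apply: ge_ereal_sup => _ [n [B [bB Bx tB ->]]].
have mB i : measurable (B i) by case: (bB i).
have mx := measurable_upper_set x.
apply: (@le_trans _ _
  (\sum_(i < n) ((P1 (B i) + N1 (B i)) + (P2 (B i) + N2 (B i))))%E).
  rewrite -sumEFin; apply: lee_sum => i _.
  apply: (@le_trans _ _ (`|Re (mu (B i))| + `|Im (mu (B i))|)%:E).
    by rewrite lee_fin normc_le_ReIm.
  rewrite EFinD -P1E -N1E -P2E -N2E; apply: leeD.
    by apply: le_coord_variation => //; exact: Re_coordinate.
  by apply: le_coord_variation => //; exact: Im_coordinate.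
by rewrite !big_split /=; do ![apply: leeD]; apply: sum_le_measure.
Qed.

Section test.
Variables (p : R[i] -> R) (f : V -> R) (N : nat).
Hypotheses (hp : complex_coordinate p) (sf : smooth f).
Hypothesis fN : forall x, ~ cbox N x -> f x = 0.
Let Psi := foldr partial f (rev (enum 'I_d)).

(** The identity for positive measures is applied to the positive and to the
   negative variation and the results are subtracted. *)
Lemma signed_integral_tail :
  leb.-integrable orthant (fun x => (p (mu (upper_set x)) * Psi x)%:E) /\
  signed_integral (fun B => p (mu B)) f =
  \int[leb]_(x in orthant) (p (mu (upper_set x)) * Psi x).
Proof.
have [P [M [PE ME hP hM]]] := coord_variation_measures hp.
have iP := integrable_tail_mixed_partial (tail_integrable_variation hP) sf fN.
have iM := integrable_tail_mixed_partial (tail_integrable_variation hM) sf fN.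
have E : {in orthant, forall x,
    p (mu (upper_set x)) * Psi x =
    fine (P (upper_set x)) * Psi x - fine (M (upper_set x)) * Psi x}.
  move=> x /set_mem x0; rewrite -mulrBl; congr (_ * _).
  have [_ _ ->] := coord_finite_variation hmu hp
    (finite_variation_upper_set x0).
  by rewrite PE ME.
split.
  apply: (eq_integrable measurable_orthant _ _ _
    (integrableB measurable_orthant iP iM)).
  by move=> x x0 /=; rewrite E// EFinB.
rewrite (eq_Rintegral _ E) RintegralB//; last exact: measurable_orthant.
rewrite /signed_integral PE ME /Rintegral.
rewrite (integral_tail_mixed_partial (tail_integrable_variation hP) sf fN).
by rewrite (integral_tail_mixed_partial (tail_integrable_variation hM) sf fN).
Qed.

End test.

End tail_potential.

Section mixed_partial_distribution.
Context {R : realType} {d : nat}.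
Local Notation V := 'rV[R]_d.

(** Each distributional derivative moves to the test function at the cost of a
   sign; the outermost distributional derivative reaches it first, whence the
   reversal of the order. *)
Lemma foldr_distr_partialE (T : functional) (s : seq 'I_d) (phi : V -> R[i]) :
  foldr distr_partial T s phi = (-1) ^+ size s * T (foldr cpartial phi (rev s)).
Proof.
elim: s phi => [|k s IH] phi /=; first by rewrite mul1r.
by rewrite /distr_partial IH rev_cons foldr_rcons exprS mulN1r mulNr.
Qed.

Lemma Re_foldr_cpartial (s : seq 'I_d) (phi : V -> R[i]) x :
  Re (foldr cpartial phi s x) = foldr partial (fun y => Re (phi y)) s x.
Proof.
elim: s x => //= k s IH x.
by rewrite (_ : (fun y => Re _) = foldr partial (fun y => Re (phi y)) s)//;
  exact/funext.
Qed.

Lemma Im_foldr_cpartial (s : seq 'I_d) (phi : V -> R[i]) x :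
  Im (foldr cpartial phi s x) = foldr partial (fun y => Im (phi y)) s x.
Proof.
elim: s x => //= k s IH x.
by rewrite (_ : (fun y => Im _) = foldr partial (fun y => Im (phi y)) s)//;
  exact/funext.
Qed.

Lemma ReM (z w : R[i]) : Re (z * w) = Re z * Re w - Im z * Im w.
Proof. by case: z w => [? ?] []. Qed.

Lemma ImM (z w : R[i]) : Im (z * w) = Re z * Im w + Im z * Re w.
Proof. by case: z w => [? ?] []. Qed.

Theorem upper_tail_potential_distr (g : V -> R[i]) (mu : set V -> R[i]) :
  upper_tail_potential g mu ->
  distr_eq (distr_of_measure mu)
    (distr_scale ((-1) ^+ d) (distr_mixed_partial (distr_of_fun g))).
Proof.
move=> [_ hmu gE mu_int] phi [sRe sIm cphi phi0].
have [N phiN] := compact_sub_cbox cphi phi0.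
have phiE x : ~ cbox N x -> phi x = 0.
  move=> xN; apply/eqP; apply: contraPT xN => nz; apply.
  by apply: phiN; exact: subset_closure.
have ReN x : ~ cbox N x -> Re (phi x) = 0 by move=> /phiE ->.
have ImN x : ~ cbox N x -> Im (phi x) = 0 by move=> /phiE ->.
have [i11 E11] := signed_integral_tail hmu mu_int (@Re_coordinate R) sRe ReN.
have [i12 E12] := signed_integral_tail hmu mu_int (@Re_coordinate R) sIm ImN.
have [i21 E21] := signed_integral_tail hmu mu_int (@Im_coordinate R) sRe ReN.
have [i22 E22] := signed_integral_tail hmu mu_int (@Im_coordinate R) sIm ImN.
rewrite /distr_scale /distr_mixed_partial foldr_distr_partialE size_enum_ord.
rewrite mulrA -exprMn mulrNN mulr1 expr1n mul1r.
rewrite /distr_of_measure /complex_integral E11 E12 E21 E22 /distr_of_fun.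
have mO := @measurable_orthant R d.
have [A [mA A0 gA]] := gE.
have gEq x : orthant x -> ~ A x -> g x = mu (upper_set x).
  by move=> x0 xA; apply: contrapT => h; apply: xA; apply: gA => /(_ x0).
congr (_ +i* _)%C.
  rewrite -RintegralB//; rewrite /Rintegral; congr fine.
  apply/esym; apply: (ae_eq_integral_set mA A0) => x x0 xA.
  by rewrite ReM Re_foldr_cpartial Im_foldr_cpartial gEq.
rewrite -RintegralD//; rewrite /Rintegral; congr fine.
apply/esym; apply: (ae_eq_integral_set mA A0) => x x0 xA.
by rewrite ImM Re_foldr_cpartial Im_foldr_cpartial gEq.
Qed.

End mixed_partial_distribution.

(** * Upper sets determine a measure *)

Section upper_sets.
Context {R : realType} {d : nat}.
Local Notation V := 'rV[R]_d.
Local Notation leb := (@lebesgue_row R d).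

Definition upper_sets : set (set V) := range upper_set.

Lemma upper_setI (x y : V) :
  upper_set x `&` upper_set y = upper_set (\row_k Num.max (x 0 k) (y 0 k)).
Proof.
apply/seteqP; split => t /=; first by move=> [xt yt] k;
  rewrite mxE ge_max xt yt.
by move=> h; split => k; have := h k; rewrite mxE ge_max => /andP[].
Qed.

Lemma setI_closed_upper_sets : setI_closed upper_sets.
Proof. by move=> _ _ [x _ <-] [y _ <-]; rewrite upper_setI; eexists. Qed.

Let lower_corner_near (x : V) : \forall n \near \oo, forall k, - n%:R <= x 0 k.
Proof.
apply: filter_forall => k; near=> n; rewrite lerNl.
near: n; exact: nbhs_infty_ger.
Unshelve. all: by end_near. Qed.

Lemma bigcup_upper_set : \bigcup_n upper_set (const_mx (- n%:R)) = [set: V].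
Proof.
apply/seteqP; split => // x _;
  have [n _ /(_ n (leqnn n)) h] := lower_corner_near x.
by exists n => // k; rewrite mxE.
Qed.

Lemma measurable_upper_setsE : @measurable _ V = <<s upper_sets >>.
Proof.
apply/seteqP; split; last first.
  apply: smallest_sub; first exact: sigma_algebra_measurable.
  by move=> _ [x _ <-]; exact: measurable_upper_set.
pose W := g_sigma_algebraType upper_sets.
have mW k :
    measurable_fun [set: W] (fun x : W => (x : V) 0 k : measurableTypeR R).
  apply: (measurability _ (RGenCInfty.measurableE R)) => _ [_ [a ->] <-].
  pose y n : V := \row_j (if j == k then a else - n%:R).
  rewrite setTI (_ : _ @^-1` _ = \bigcup_n upper_set (y n)).
    by apply: bigcupT_measurable => n; apply: sub_sigma_algebra; exists (y n).
  apply/seteqP; split => x /=.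
    rewrite in_itv/= andbT => ax.
    have [n _ /(_ n (leqnn n)) h] := lower_corner_near x.
    by exists n => // j; rewrite mxE; case: eqP => [->|_].
  by move=> [n _ /(_ k)]; rewrite mxE eqxx in_itv/= andbT.
have mid : measurable_fun [set: W] (id : W -> V) by exact: measurable_fun_row.
by move=> A mA; have := mid measurableT A mA; rewrite setTI.
Qed.

(** The pi-lambda theorem, on the trace of the measures on one upper set that
   contains B: there both measures are finite, and the trace of any upper set is
   the upper set of a point of the orthant. *)
Lemma eq_measure_upper (m1 m2 : {measure set V -> \bar R}) :
  (forall x, orthant x -> m1 (upper_set x) = m2 (upper_set x)) ->
  (forall x, orthant x -> (m1 (upper_set x) < +oo)%E) ->
  forall B, bounded_borel B -> m1 B = m2 B.
Proof.
move=> m12 mfin B [mB [K [cK K0 BK]]].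
have [N KN] := compact_sub_cbox cK K0.
pose c : V := const_mx N.+1%:R^-1.
pose U := upper_set c.
have mU : measurable U by exact: measurable_upper_set.
have BU : B `&` U = B.
  by apply/setIidPl => x /BK /KN xN k; rewrite mxE; have /andP[] := xN k.
have c0 (x : V) : orthant (\row_k Num.max (x 0 k) (c 0 k)).
  by move=> k; rewrite !mxE lt_max invr_gt0 ltr0n orbT.
have : mrestr m1 mU B = mrestr m2 mU B.
  apply: (measure_unique upper_sets (fun n => upper_set (const_mx (- n%:R))))
    => //.
  - exact: measurable_upper_setsE.
  - exact: setI_closed_upper_sets.
  - by move=> n; eexists.
  - exact: bigcup_upper_set.
  - by move=> _ [x _ <-]; rewrite /= /mrestr upper_setI m12.
  - by move=> n; rewrite /= /mrestr upper_setI mfin.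
by rewrite /mrestr BU.
Qed.

(** Left limits of tails can be computed along points where a property known
   almost everywhere holds.  The n-th point is picked in the box between
   (1 - 1/(n+1)) x and (1 - 1/(n+2)) x, which has positive measure; as
   consecutive boxes share a corner, the sequence increases. *)
Lemma ae_left_sequence (A : set V) (x : V) : measurable A -> leb A = 0%E ->
    orthant x ->
  exists y : nat -> V, [/\ forall n, orthant (y n), forall n, ~ A (y n),
    {homo (fun n => upper_set (y n)) : n m / (n <= m)%N >-> m `<=` n} &
    \bigcap_n upper_set (y n) = upper_set x].
Proof.
move=> mA A0 x0.
pose a n k := x 0 k * (1 - n.+1%:R^-1).
have a0 n k : 0 <= a n k.
  by apply: mulr_ge0; [exact: ltW|rewrite subr_ge0 invf_le1 ?ler1n ?ltr0n].
have ax n k : a n k < x 0 k.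
  by rewrite /a gtr_pMr// gtrBl invr_gt0 ltr0n.
have aS n k : a n k < a n.+1 k.
  by rewrite /a ltr_pM2l// ltrD2l ltrN2 ltf_pV2 ?posrE ?ltr0n// ltr_nat.
have /choice[y yP] : forall n, exists y, obox (a n) (a n.+1) y /\ ~ A y.
  move=> n; apply: contrapT => h.
  have sub : obox (a n) (a n.+1) `<=` A.
    by move=> y yb; apply: contrapT => yA; apply: h; exists y.
  have : (leb (obox (a n) (a n.+1)) <= leb A)%E.
    by apply: le_measure; rewrite ?inE//; exact: measurable_obox.
  rewrite [leRHS]A0 lebesgue_row_obox; last by move=> k; exact: ltW.
  by rewrite lee_fin leNgt => /negP; apply; apply: prodr_gt0 => k _;
    rewrite subr_gt0.
have yb n k : a n k < y n 0 k <= a n.+1 k by have [+ _] := yP n; exact.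
have yS n k : y n 0 k <= y n.+1 0 k.
  have /andP[_ h1] := yb n k; have /andP[h2 _] := yb n.+1 k.
  exact: le_trans h1 (ltW h2).
exists y; split.
- by move=> n k; have /andP[+ _] := yb n k; exact: le_lt_trans.
- by move=> n; have [] := yP n.
- move=> n m nm t yt k; apply: le_trans (yt k).
  have : {homo (fun n => y n 0 k) : n m / (n <= m)%N >-> n <= m}.
    by apply: homo_leq => //; exact: le_trans.
  exact.
apply/seteqP; split => t; last first.
  move=> xt n _ k; apply: le_trans (xt k).
  by have /andP[_ h] := yb n k; apply: le_trans h (ltW (ax _ _)).
move=> h k; rewrite leNgt; apply/negP => tx.
have e0 : 0 < (x 0 k - t 0 k) / x 0 k by rewrite divr_gt0 ?subr_gt0.
have [n _ /(_ n (leqnn n))/= ne] := near_infty_natSinv_lt (PosNum e0).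
have := h n I k; apply/negP; rewrite -ltNge.
have /andP[+ _] := yb n k; apply: le_lt_trans.
rewrite /a mulrBr mulr1 lerBrDr -lerBrDl.
by rewrite -(ler_pdivlMl _ _ (x0 k)) mulrC ltW.
Qed.

End upper_sets.

(** * Uniqueness of the representing measure *)

Section uniqueness.
Context {R : realType} {d : nat}.
Local Notation V := 'rV[R]_d.
Local Notation leb := (@lebesgue_row R d).

(** Tails are left-continuous because the variations are continuous from
   above. *)
Lemma tail_left_continuous (mu : set V -> R[i]) (p : R[i] -> R) (y : nat -> V)
    (x : V) :
  complex_radon mu ->
  tail_integrable (abs_variation mu) ->
  complex_coordinate p -> orthant x -> (forall n, orthant (y n)) ->
  {homo (fun n => upper_set (y n)) : n m / (n <= m)%N >-> m `<=` n} ->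
  \bigcap_n upper_set (y n) = upper_set x ->
  p (mu (upper_set (y n))) @[n --> \oo] --> p (mu (upper_set x)).
Proof.
move=> hmu mu_int hp x0 y0 ydec yx.
have [P [M [PE ME hP hM]]] := coord_variation_measures hmu hp.
have cvg_fine (m : {sigma_finite_measure set V -> \bar R}) :
    (forall A, (m A <= abs_variation mu A)%E) ->
    fine (m (upper_set (y n))) @[n --> \oo] --> fine (m (upper_set x)).
  move=> /(tail_integrable_variation hmu mu_int) h; apply: fine_cvg.
  rewrite fineK ?(tail_fin h)// -yx.
  apply: nonincreasing_cvg_mu.
  - by rewrite ltey_eq (tail_fin h).
  - by move=> n; exact: measurable_upper_set.
  - by rewrite yx; exact: measurable_upper_set.
  - by move=> n k nk; apply/subsetPset; exact: ydec.
have E z : orthant z ->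
    p (mu (upper_set z)) = fine (P (upper_set z)) - fine (M (upper_set z)).
  move=> /(finite_variation_upper_set hmu mu_int)/(coord_finite_variation hmu
    hp)[_ _ ->].
  by rewrite PE ME.
rewrite E//; under eq_fun do rewrite E//.
by apply: cvgB; exact: cvg_fine.
Qed.

(** Both tails equal g almost everywhere, and every point of the orthant is the
   limit from below of points where they do. *)
Lemma upper_tail_potential_eq_tails (g : V -> R[i]) (mu nu : set V -> R[i]) :
  upper_tail_potential g mu -> upper_tail_potential g nu ->
  forall x, orthant x -> mu (upper_set x) = nu (upper_set x).
Proof.
move=> [_ hmu [A [mA A0 gA]] mu_int] [_ hnu [B [mB B0 gB]] nu_int] x x0.
have mAB : measurable (A `|` B) by exact: measurableU.
have AB0 : leb (A `|` B) = 0%E.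
  exact: etrans (measureU0 mA mB B0) A0.
have [y [y0 yAB ydec yx]] := ae_left_sequence mAB AB0 x0.
have yE n : mu (upper_set (y n)) = nu (upper_set (y n)).
  transitivity (g (y n)).
    apply: contrapT => h; apply: (yAB n); left; apply: gA => /(_ (y0 n))/esym;
      exact: h.
  apply: contrapT => h; apply: (yAB n); right; apply: gB => /(_ (y0 n));
    exact: h.
have pE p : complex_coordinate p -> p (mu (upper_set x)) = p (nu (upper_set x)).
  move=> hp.
  have h1 := tail_left_continuous hmu mu_int hp x0 y0 ydec yx.
  have h2 := tail_left_continuous hnu nu_int hp x0 y0 ydec yx.
  move: h1; under eq_fun do rewrite yE.
  by move=> h1; exact: cvg_unique h1 h2.
have := pE _ (@Re_coordinate R); have := pE _ (@Im_coordinate R).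
by case: (mu _) (nu _) => [a b] [a' b'] /= -> ->.
Qed.

(** The real charges P - M and P' - M' have the same tails; moving the
   negative parts across gives positive measures P + M' and P' + M with the
   same tails. *)
Lemma coordinate_bounded_borel_eq (mu nu : set V -> R[i]) (p : R[i] -> R) :
  complex_radon mu -> complex_radon nu ->
  tail_integrable (abs_variation mu) ->
  tail_integrable (abs_variation nu) ->
  complex_coordinate p ->
  (forall x, orthant x -> mu (upper_set x) = nu (upper_set x)) ->
  forall B, bounded_borel B -> p (mu B) = p (nu B).
Proof.
move=> hmu hnu mu_int nu_int hp tail B bB.
have [P0 [M0 [PE ME hP hM]]] := coord_variation_measures hmu hp.
have [P1 [M1 [PE' ME' hP' hM']]] := coord_variation_measures hnu hp.
pose P : {measure set V -> \bar R} := P0.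
pose M : {measure set V -> \bar R} := M0.
pose P' : {measure set V -> \bar R} := P1.
pose M' : {measure set V -> \bar R} := M1.
have muE A : finite_variation mu A ->
    [/\ P A \is a fin_num, M A \is a fin_num &
        p (mu A) = fine (P A) - fine (M A)].
  by move=> /(coord_finite_variation hmu hp); rewrite PE ME.
have nuE A : finite_variation nu A ->
    [/\ P' A \is a fin_num, M' A \is a fin_num &
        p (nu A) = fine (P' A) - fine (M' A)].
  by move=> /(coord_finite_variation hnu hp); rewrite PE' ME'.
have : measure_add P M' B = measure_add P' M B.
  apply: (eq_measure_upper (m1 := measure_add P M') (m2 := measure_add P' M))
    => //.
    move=> x x0; rewrite [LHS](measure_addE P M') [RHS](measure_addE P' M).
    have [fP fM e] := muE _ (finite_variation_upper_set hmu mu_int x0).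
    have [fP' fM' e'] := nuE _ (finite_variation_upper_set hnu nu_int x0).
    rewrite -(fineK fP) -(fineK fM) -(fineK fP') -(fineK fM') -!EFinD;
      congr EFin.
    by have := congr1 p (tail x x0); rewrite e e'; lra.
  move=> x x0; rewrite [X in (X < _)%E](measure_addE P M').
  have [fP _ _] := muE _ (finite_variation_upper_set hmu mu_int x0).
  have [_ fM' _] := nuE _ (finite_variation_upper_set hnu nu_int x0).
  by rewrite lte_add_pinfty// ltey_eq ?fP ?fM'.
have [fP fM ->] := muE _ (bounded_borel_finite_variation hmu bB).
have [fP' fM' ->] := nuE _ (bounded_borel_finite_variation hnu bB).
rewrite !measure_addE -(fineK fP) -(fineK fM) -(fineK fP') -(fineK fM')
  -!EFinD => -[].
by move=> h; lra.
Qed.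

(** The total variation and the variations of both coordinates are suprema over
   relatively compact Borel sets, and they determine the rest. *)
Lemma complex_radon_eq_bounded_borel (mu nu : set V -> R[i]) :
  complex_radon mu -> complex_radon nu ->
  (forall B, bounded_borel B -> mu B = nu B) -> complex_radon_eq mu nu.
Proof.
move=> hmu hnu mn.
have absE : abs_variation mu = abs_variation nu.
  apply/funext => A; congr ereal_sup; apply/seteqP;
    split => s [n [B [bB BA tB ->]]];
    exists n, B; split => //; congr EFin; apply: eq_bigr => i _; by rewrite mn.
have fvE A : finite_variation mu A <-> finite_variation nu A.
  by rewrite /finite_variation absE.
split=> // A fA.
have pE p : complex_coordinate p -> p (mu A) = p (nu A).
  move=> hp.
  have [_ _ ->] := coord_finite_variation hmu hp fA.
  have [_ _ ->] := coord_finite_variation hnu hp ((fvE A).1 fA).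
  have posE (q : R[i] -> R) :
      pos_variation (fun B => q (mu B)) A = pos_variation (fun B => q (nu B)) A.
    congr ereal_sup; apply/seteqP; split => s [B [bB BA] <-]; exists B => //;
      by rewrite mn.
  by rewrite /neg_variation posE (posE (fun z => - p z)).
have := pE _ (@Re_coordinate R); have := pE _ (@Im_coordinate R).
by case: (mu A) (nu A) => [a b] [a' b'] /= -> ->.
Qed.

Theorem upper_tail_potential_unique (g : V -> R[i]) (mu nu : set V -> R[i]) :
  upper_tail_potential g mu -> upper_tail_potential g nu ->
  complex_radon_eq mu nu.
Proof.
move=> gmu gnu; have tail := upper_tail_potential_eq_tails gmu gnu.
case: gmu gnu => [_ hmu _ mu_int] [_ hnu _ nu_int].
apply: complex_radon_eq_bounded_borel => // B bB.
have := coordinate_bounded_borel_eq hmu hnu mu_int nu_int (@Re_coordinate R)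
  tail bB.
have := coordinate_bounded_borel_eq hmu hnu mu_int nu_int (@Im_coordinate R)
  tail bB.
by case: (mu B) (nu B) => [a b] [a' b'] /= -> ->.
Qed.

End uniqueness.

Theorem lemma3p3 (R : realType) (d : nat) (hd : (1 <= d)%N)
    (g : 'rV[R]_d -> complex R) (mu : set 'rV[R]_d -> complex R)
    (hg : upper_tail_potential g mu) :
  distr_eq (distr_of_measure mu)
    (distr_scale ((-1) ^+ d)%R (distr_mixed_partial (distr_of_fun g))) /\
  (forall nu : set 'rV[R]_d -> complex R,
    upper_tail_potential g nu -> complex_radon_eq mu nu).
Proof.
split; first exact: upper_tail_potential_distr.
by move=> nu; exact: upper_tail_potential_unique.
Qed.
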